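(* For every $S\subseteq\omega$: $S=\Theta(S)$ if and only if $(\mathbb{N},S)\vDash\mathrm{IT}^-$.
   Context: $\mathcal{L}_\mathbb{N}$ is the language of PA extended with finitely many primitive recursive function symbols, including syntactic operations on codes $\dot\neg,\dot\vee,\dot\wedge,\dot\forall,\dot\exists,\dot\rightarrow,\dot=,\dot\neq$, $\dot{\mathrm{Tr}}$ (code of a closed term $t$ $\mapsto$ code of $\mathrm{Tr}(t)$; $\dot{\mathrm{Tr}}\,x$ for a number $x$ means $\dot{\mathrm{Tr}}$ applied to the numeral of $x$) and substitution $x(t/v)$. $\mathcal{L}_\mathrm{Tr}=\mathcal{L}_\mathbb{N}\cup\{\mathrm{Tr}\}$; $\mathrm{PAT}$ is PA in $\mathcal{L}_\mathrm{Tr}$ with full induction. $\ulcorner\varphi\urcorner$ is the numeral of the code of $\varphi$; variables $s,t$ range over codes of closed terms, $t^\circ$ is the value; $\mathrm{Sent}(x)$ represents codes of sentences; $\mathrm{Pr}_{\mathrm{PAT}}$ standard provability predicate; $\mathrm{True}_0$ the set of codes of true $\mathcal{L}_\mathbb{N}$-literals; $(\mathbb{N},S)$ interprets $\mathrm{Tr}$ by $S$. $\xi(x,X)$ is the disjunction of: $x\in\mathrm{True}_0$; $\exists y(x=\dot\neg\dot\neg y\wedge y\in X)$; $\exists y,z(x=y\dot\vee z\wedge(y\in X\vee z\in X))$; $\exists y,z(x=\dot\neg(y\dot\vee z)\wedge\dot\neg y\in X\wedge\dot\neg z\in X)$; $\exists y,z(x=y\dot\wedge z\wedge y\in X\wedge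 z\in X)$; $\exists y,z(x=\dot\neg(y\dot\wedge z)\wedge(\dot\neg y\in X\vee\dot\neg z\in X))$; $\exists y,v(x=\dot\forall vy\wedge\forall z(y(z/v)\in X))$; $\exists y,v(x=\dot\neg\dot\forall vy\wedge\exists z(\dot\neg y(z/v)\in X))$; $\exists y,v(x=\dot\exists vy\wedge\exists z(y(z/v)\in X))$; $\exists y,v(x=\dot\neg\dot\exists vy\wedge\forall z(\dot\neg y(z/v)\in X))$; $\exists t(x=\dot{\mathrm{Tr}}(t)\wedge t^\circ\in X)$; $\exists t(x=\dot\neg\dot{\mathrm{Tr}}(t)\wedge(\dot\neg t^\circ\in X\vee\neg\mathrm{Sent}(t^\circ)))$. $\xi(z,\mathrm{Tr})$ replaces ''$w\in X$'' by $\mathrm{Tr}(w)$. $\Theta(S)=\{n:\mathbb{N}\vDash\exists y(\xi(y,S)\wedge\mathrm{Pr}_{\mathrm{PAT}}(y\dot\rightarrow\bar n))\}$. $\mathrm{IT}^-$ is $\mathrm{PAT}$ plus: (IT1) $\forall s,t(\mathrm{Tr}(s\dot=t)\leftrightarrow s^\circ=t^\circ)\wedge\forall s,t(\mathrm{Tr}(s\dot\neq t)\leftrightarrow s^\circ\neq t^\circ)$; (IT2) $\forall x,y(\mathrm{Sent}(x\dot\wedge y)\rightarrow(\mathrm{Tr}(x)\wedge\mathrm{Tr}(y)\rightarrow\mathrm{Tr}(x\dot\wedge y)))$; (IT3) $\forall x,y(\mathrm{Sent}(x\dot\vee y)\rightarrow(\mathrm{Tr}(x)\vee\mathrm{Tr}(y)\vee\exists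 z(\xi(z,\mathrm{Tr})\wedge\mathrm{Pr}_{\mathrm{PAT}}(z\dot\rightarrow x\dot\vee y))\leftrightarrow\mathrm{Tr}(x\dot\vee y)))$; (IT4) $\forall x,v(\mathrm{Sent}(\dot\forall vx)\rightarrow(\forall t\,\mathrm{Tr}(x(t/v))\rightarrow\mathrm{Tr}(\dot\forall vx)))$; (IT5) $\forall x,v(\mathrm{Sent}(\dot\exists vx)\rightarrow(\exists t\,\mathrm{Tr}(x(t/v))\vee\exists w(\xi(w,\mathrm{Tr})\wedge\mathrm{Pr}_{\mathrm{PAT}}(w\dot\rightarrow\dot\exists vx))\leftrightarrow\mathrm{Tr}(\dot\exists vx)))$; (IT$^-$6) $\forall x(\mathrm{Tr}(x)\rightarrow\mathrm{Tr}(\dot{\mathrm{Tr}}\,x))$; (IT$^-$7) $\forall t(\mathrm{Tr}(\dot\neg t)\vee\neg\mathrm{Sent}(t)\rightarrow\mathrm{Tr}(\dot\neg\dot{\mathrm{Tr}}\,t))$; (IT8) $\forall x,y(\mathrm{Tr}(x)\wedge\mathrm{Pr}_{\mathrm{PAT}}(x\dot\rightarrow y)\rightarrow\mathrm{Tr}(y))$; (IT9) $\forall x(\mathrm{Tr}(\dot\neg x)\rightarrow\neg\mathrm{Tr}(x))$; (IT10) $\mathrm{Tr}\ulcorner\forall x(\mathrm{Tr}(x)\rightarrow\mathrm{Sent}(x))\urcorner$.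
   Formalization: The set S of codes of all sentences is excluded: it satisfies S = Θ(S) (via A∧A → A) but violates IT9. In IT⁻7, t on the left is read as its value t°; read literally, ¬Sent(t) always holds and IT⁻ has no model (N,S). *)

(* Defs.v *)
From Stdlib Require List.
From mathcomp Require Import all_boot.
From mathcomp Require Import boolp classical_sets.

Set Implicit Arguments.
Unset Strict Implicit.
Unset Printing Implicit Defensive.

Local Open Scope classical_set_scope.

(** * Syntax of L_Tr *)

(* [Fun i ts] applies the [i]-th additional primitive recursive function symbol;
   variables are identified with their indices. *)
Inductive term : Type :=
| Var (v : nat)
| Zero
| Succ (t : term)
| Add (s t : term)
| Mul (s t : term)
| Fun (i : nat) (ts : seq term).

(* Implication is not primitive: it abbreviates [~ A \/ B]. *)
Inductive form : Type :=
| Eq (s t : term)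
| Tr (t : term)
| Neg (A : form)
| Or (A B : form)
| And (A B : form)
| All (v : nat) (A : form)
| Ex (v : nat) (A : form).

Definition Imp (A B : form) : form := Or (Neg A) B.
Definition Iff (A B : form) : form := And (Imp A B) (Imp B A).

Definition numeral (n : nat) : term := iter n Succ Zero.

Fixpoint fvt (t : term) : seq nat :=
  match t with
  | Var v => [:: v]
  | Zero => [::]
  | Succ t => fvt t
  | Add s t | Mul s t => fvt s ++ fvt t
  | Fun _ ts => flatten (map fvt ts)
  end.

Fixpoint fv (A : form) : seq nat :=
  match A with
  | Eq s t => fvt s ++ fvt t
  | Tr t => fvt t
  | Neg A => fv A
  | Or A B | And A B => fv A ++ fv B
  | All v A | Ex v A => [seq w <- fv A | w != v]
  end.

Fixpoint substt (r : term) (v : nat) (t : term) : term :=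
  match t with
  | Var w => if w == v then r else Var w
  | Zero => Zero
  | Succ t => Succ (substt r v t)
  | Add s t => Add (substt r v s) (substt r v t)
  | Mul s t => Mul (substt r v s) (substt r v t)
  | Fun i ts => Fun i (map (substt r v) ts)
  end.

(* Does not rename bound variables; it is only used under [free_for], which
   holds in particular when [r] is closed. *)
Fixpoint subst (r : term) (v : nat) (A : form) : form :=
  match A with
  | Eq s t => Eq (substt r v s) (substt r v t)
  | Tr t => Tr (substt r v t)
  | Neg A => Neg (subst r v A)
  | Or A B => Or (subst r v A) (subst r v B)
  | And A B => And (subst r v A) (subst r v B)
  | All w A => if w == v then All w A else All w (subst r v A)
  | Ex w A => if w == v then Ex w A else Ex w (subst r v A)
  end.

Fixpoint free_for (r : term) (v : nat) (A : form) : bool :=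
  match A with
  | Eq _ _ | Tr _ => true
  | Neg A => free_for r v A
  | Or A B | And A B => free_for r v A && free_for r v B
  | All w A | Ex w A =>
      (v \notin [seq u <- fv A | u != w]) ||
      ((w \notin fvt r) && free_for r v A)
  end.

Fixpoint Tr_free (A : form) : bool :=
  match A with
  | Eq _ _ => true
  | Tr _ => false
  | Neg A | All _ A | Ex _ A => Tr_free A
  | Or A B | And A B => Tr_free A && Tr_free B
  end.

(** * Primitive recursive function symbols *)

(* [Expl n t] introduces the n-ary symbol f with
     f(x_0,...,x_{n-1}) = t,
   and [PRec n g h] the (n+1)-ary symbol f with
     f(0, x_0,...,x_{n-1})   = g
     f(S y, x_0,...,x_{n-1}) = h[x_n := y, x_{n+1} := f(y, x_0,...,x_{n-1})],
   where t, g and h only use symbols introduced before f. *)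
Inductive prdef : Type :=
| Expl (n : nat) (t : term)
| PRec (n : nat) (g h : term).

Definition prdef_arity (d : prdef) : nat :=
  match d with Expl n _ => n | PRec n _ _ => n.+1 end.

(* The most recent definition comes first, so that in [d :: P] the symbol
   defined by [d] has index [size P]. *)
Definition prsig : Type := seq prdef.

Fixpoint arity (P : prsig) (i : nat) : option nat :=
  match P with
  | [::] => None
  | d :: P' => if i == size P' then Some (prdef_arity d) else arity P' i
  end.

Fixpoint term_ok (P : prsig) (t : term) : bool :=
  match t with
  | Var _ | Zero => true
  | Succ t => term_ok P t
  | Add s t | Mul s t => term_ok P s && term_ok P t
  | Fun i ts => (arity P i == Some (size ts)) && all (term_ok P) ts
  end.

Fixpoint form_ok (P : prsig) (A : form) : bool :=
  match A with
  | Eq s t => term_ok P s && term_ok P t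
  | Tr t => term_ok P t
  | Neg A | All _ A | Ex _ A => form_ok P A
  | Or A B | And A B => form_ok P A && form_ok P B
  end.

Definition term_in (P : prsig) (n : nat) (t : term) : bool :=
  term_ok P t && all (fun v => v < n) (fvt t).

Definition prdef_ok (P : prsig) (d : prdef) : bool :=
  match d with
  | Expl n t => term_in P n t
  | PRec n g h => term_in P n g && term_in P n.+2 h
  end.

Fixpoint prsig_ok (P : prsig) : bool :=
  match P with
  | [::] => true
  | d :: P' => prdef_ok P' d && prsig_ok P'
  end.

Definition closed_term (P : prsig) (t : term) : bool := term_in P 0 t.

Definition sentence (P : prsig) (A : form) : bool :=
  form_ok P A && (fv A == [::]).

(* L_N-formulas whose free variables are among x_0,...,x_{k-1}. *)
Definition LN_form (P : prsig) (k : nat) (A : form) : bool :=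
  [&& form_ok P A, Tr_free A & all (fun v => v < k) (fv A)].

(** * Semantics: the structures (N, S) *)

Fixpoint teval (I : nat -> seq nat -> nat) (e : nat -> nat) (t : term) : nat :=
  match t with
  | Var v => e v
  | Zero => 0
  | Succ t => (teval I e t).+1
  | Add s t => teval I e s + teval I e t
  | Mul s t => teval I e s * teval I e t
  | Fun i ts => I i (map (teval I e) ts)
  end.

Definition prdef_interp (I : nat -> seq nat -> nat) (d : prdef)
    (args : seq nat) : nat :=
  match d with
  | Expl _ t => teval I (nth 0 args) t
  | PRec _ g h =>
      let xs := behead args in
      nat_rec (fun _ => nat) (teval I (nth 0 xs) g)
        (fun y r => teval I (nth 0 (xs ++ [:: y; r])) h) (head 0 args)
  end.

Fixpoint interp (P : prsig) (i : nat) : seq nat -> nat :=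
  match P with
  | [::] => fun _ => 0
  | d :: P' => if i == size P' then prdef_interp (interp P') d else interp P' i
  end.

Definition upd (e : nat -> nat) (v n : nat) : nat -> nat :=
  fun w => if w == v then n else e w.

Fixpoint sat (P : prsig) (S : set nat) (e : nat -> nat) (A : form) : Prop :=
  match A with
  | Eq s t => teval (interp P) e s = teval (interp P) e t
  | Tr t => S (teval (interp P) e t)
  | Neg A => ~ sat P S e A
  | Or A B => sat P S e A \/ sat P S e B
  | And A B => sat P S e A /\ sat P S e B
  | All v A => forall n, sat P S (upd e v n) A
  | Ex v A => exists n, sat P S (upd e v n) A
  end.

(* (N, S) |= T; free variables of axioms are read as universally quantified. *)
Definition models (P : prsig) (S : set nat) (T : set form) : Prop :=
  forall A, T A -> forall e, sat P S e A.

(** * Coding *)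

(* [CodeSeq.code] is a bijection from [seq nat] to [nat]. *)
Definition gneg (x : nat) : nat := CodeSeq.code [:: 8; x].
Definition gor (x y : nat) : nat := CodeSeq.code [:: 9; x; y].
Definition gand (x y : nat) : nat := CodeSeq.code [:: 10; x; y].
Definition gall (v x : nat) : nat := CodeSeq.code [:: 11; v; x].
Definition gex (v x : nat) : nat := CodeSeq.code [:: 12; v; x].
Definition geq (s t : nat) : nat := CodeSeq.code [:: 6; s; t].
Definition gTr (t : nat) : nat := CodeSeq.code [:: 7; t].
Definition gimp (x y : nat) : nat := gor (gneg x) y.
Definition gneq (s t : nat) : nat := gneg (geq s t).

Fixpoint tcode (t : term) : nat :=
  match t with
  | Var v => CodeSeq.code [:: 0; v]
  | Zero => CodeSeq.code [:: 1]
  | Succ t => CodeSeq.code [:: 2; tcode t]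
  | Add s t => CodeSeq.code [:: 3; tcode s; tcode t]
  | Mul s t => CodeSeq.code [:: 4; tcode s; tcode t]
  | Fun i ts => CodeSeq.code [:: 5, i & map tcode ts]
  end.

Fixpoint code (A : form) : nat :=
  match A with
  | Eq s t => geq (tcode s) (tcode t)
  | Tr t => gTr (tcode t)
  | Neg A => gneg (code A)
  | Or A B => gor (code A) (code B)
  | And A B => gand (code A) (code B)
  | All v A => gall v (code A)
  | Ex v A => gex v (code A)
  end.

Definition Sentences (P : prsig) : set nat :=
  [set n | exists2 A, sentence P A & n = code A].

Definition ClosedTerms (P : prsig) : set nat :=
  [set n | exists2 t, closed_term P t & n = tcode t].

Definition has_value (P : prsig) (n m : nat) : Prop :=
  exists2 t, closed_term P t &
    n = tcode t /\ m = teval (interp P) (fun _ => 0) t.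

(** * PAT: a Hilbert calculus with modus ponens and generalization *)

Fixpoint truth_value (b : form -> bool) (A : form) : bool :=
  match A with
  | Neg A => ~~ truth_value b A
  | Or A B => truth_value b A || truth_value b B
  | And A B => truth_value b A && truth_value b B
  | _ => b A
  end.

Definition tautology (A : form) : Prop := forall b, truth_value b A.

Inductive logical_axiom : set form :=
| ax_taut A : tautology A -> logical_axiom A
| ax_all_inst v A t : free_for t v A ->
    logical_axiom (Imp (All v A) (subst t v A))
| ax_all_distr v A B : v \notin fv A ->
    logical_axiom (Imp (All v (Imp A B)) (Imp A (All v B)))
| ax_ex v A : logical_axiom (Iff (Ex v A) (Neg (All v (Neg A))))
| ax_eq_refl t : logical_axiom (Eq t t)
| ax_eq_subst s t v A : free_for s v A -> free_for t v A ->
    logical_axiom (Imp (Eq s t) (Imp (subst s v A) (subst t v A))).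

Definition vars (n : nat) : seq term := map Var (iota 0 n).

Definition defining_equations (i : nat) (d : prdef) : seq form :=
  match d with
  | Expl n t => [:: Eq (Fun i (vars n)) t]
  | PRec n g h =>
      [:: Eq (Fun i (Zero :: vars n)) g;
          Eq (Fun i (Succ (Var n) :: vars n))
             (substt (Fun i (Var n :: vars n)) n.+1 h)]
  end.

Fixpoint prsig_equations (P : prsig) : seq form :=
  match P with
  | [::] => [::]
  | d :: P' => defining_equations (size P') d ++ prsig_equations P'
  end.

(* In the induction scheme, substituting [Succ (Var v)] for [v] never
   captures a variable. *)
Inductive PAT (P : prsig) : set form :=
| PAT_succ0 : PAT P (Neg (Eq (Succ (Var 0)) Zero))
| PAT_succ_inj :
    PAT P (Imp (Eq (Succ (Var 0)) (Succ (Var 1))) (Eq (Var 0) (Var 1)))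
| PAT_add0 : PAT P (Eq (Add (Var 0) Zero) (Var 0))
| PAT_addS :
    PAT P (Eq (Add (Var 0) (Succ (Var 1))) (Succ (Add (Var 0) (Var 1))))
| PAT_mul0 : PAT P (Eq (Mul (Var 0) Zero) Zero)
| PAT_mulS :
    PAT P (Eq (Mul (Var 0) (Succ (Var 1))) (Add (Mul (Var 0) (Var 1)) (Var 0)))
| PAT_def A : List.In A (prsig_equations P) -> PAT P A
| PAT_induction v A : form_ok P A ->
    PAT P (Imp (And (subst Zero v A)
                    (All v (Imp A (subst (Succ (Var v)) v A))))
               (All v A)).

(* Proofs are finite sequences of formulas, listed with the last line first. *)
Inductive PAT_proof (P : prsig) : seq form -> Prop :=
| proof_nil : PAT_proof P [::]
| proof_logical A l :
    PAT_proof P l -> form_ok P A -> logical_axiom A -> PAT_proof P (A :: l)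
| proof_axiom A l : PAT_proof P l -> PAT P A -> PAT_proof P (A :: l)
| proof_mp A B l :
    PAT_proof P l -> List.In A l -> List.In (Imp A B) l -> PAT_proof P (B :: l)
| proof_gen v A l : PAT_proof P l -> List.In A l -> PAT_proof P (All v A :: l).

(* [p] codes a PAT-proof of the sentence coded by [n].  Proofs may contain open
   formulas, but only sentences count as theorems. *)
Definition proves (P : prsig) (n p : nat) : Prop :=
  exists A l, [/\ sentence P A, n = code A,
    p = CodeSeq.code (map code (A :: l)) & PAT_proof P (A :: l)].

(** * The language L_N with its arithmetized syntax *)

(* A finite primitive recursive signature with symbols for the syntactic
   operations, together with L_N-formulas Sent(x_0), "x_0 is a closed term",
   "the closed term x_0 has value x_1" and "x_1 is a PAT-proof of x_0".
   The value of closed terms is given by a formula, because by diagonalization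
   no language contains a function symbol evaluating all its own closed terms.
   A variable is represented by its index in [dall], [dex] and [dsub]. *)
Record language : Type := Language {
  signature : prsig;
  signature_ok : prsig_ok signature;

  sym_neg : nat; sym_or : nat; sym_and : nat; sym_imp : nat; sym_all : nat;
  sym_ex : nat; sym_eq : nat; sym_neq : nat; sym_Tr : nat;
  sym_num : nat; sym_sub : nat;

  arity_neg : arity signature sym_neg = Some 1;
  arity_or : arity signature sym_or = Some 2;
  arity_and : arity signature sym_and = Some 2;
  arity_imp : arity signature sym_imp = Some 2;
  arity_all : arity signature sym_all = Some 2;
  arity_ex : arity signature sym_ex = Some 2;
  arity_eq : arity signature sym_eq = Some 2;
  arity_neq : arity signature sym_neq = Some 2;
  arity_Tr : arity signature sym_Tr = Some 1;
  arity_num : arity signature sym_num = Some 1;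
  arity_sub : arity signature sym_sub = Some 3;

  interp_neg : forall x, interp signature sym_neg [:: x] = gneg x;
  interp_or : forall x y, interp signature sym_or [:: x; y] = gor x y;
  interp_and : forall x y, interp signature sym_and [:: x; y] = gand x y;
  interp_imp : forall x y, interp signature sym_imp [:: x; y] = gimp x y;
  interp_all : forall v x, interp signature sym_all [:: v; x] = gall v x;
  interp_ex : forall v x, interp signature sym_ex [:: v; x] = gex v x;
  interp_eq : forall s t, interp signature sym_eq [:: s; t] = geq s t;
  interp_neq : forall s t, interp signature sym_neq [:: s; t] = gneq s t;
  interp_Tr : forall t, interp signature sym_Tr [:: t] = gTr t;
  interp_num : forall n, interp signature sym_num [:: n] = tcode (numeral n);
  interp_sub : forall A t v, form_ok signature A -> closed_term signature t ->
    interp signature sym_sub [:: code A; tcode t; v] = code (subst t v A);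

  Sent_form : form;
  Sent_form_ok : LN_form signature 1 Sent_form;
  Sent_formP : forall e,
    sat signature set0 e Sent_form <-> Sentences signature (e 0);

  ClTerm_form : form;
  ClTerm_form_ok : LN_form signature 1 ClTerm_form;
  ClTerm_formP : forall e,
    sat signature set0 e ClTerm_form <-> ClosedTerms signature (e 0);

  Val_form : form;
  Val_form_ok : LN_form signature 2 Val_form;
  Val_formP : forall e,
    sat signature set0 e Val_form <-> has_value signature (e 0) (e 1);

  Prf_form : form;
  Prf_form_ok : LN_form signature 2 Prf_form;
  Prf_formP : forall e,
    sat signature set0 e Prf_form <-> proves signature (e 0) (e 1)
}.

Definition dneg (L : language) (x : term) := Fun (sym_neg L) [:: x].
Definition dor (L : language) (x y : term) := Fun (sym_or L) [:: x; y].
Definition dand (L : language) (x y : term) := Fun (sym_and L) [:: x; y].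
Definition dimp (L : language) (x y : term) := Fun (sym_imp L) [:: x; y].
Definition dall (L : language) (v x : term) := Fun (sym_all L) [:: v; x].
Definition dex (L : language) (v x : term) := Fun (sym_ex L) [:: v; x].
Definition deq (L : language) (s t : term) := Fun (sym_eq L) [:: s; t].
Definition dneq (L : language) (s t : term) := Fun (sym_neq L) [:: s; t].
Definition dTr (L : language) (t : term) := Fun (sym_Tr L) [:: t].
Definition dnum (L : language) (x : term) := Fun (sym_num L) [:: x].
(* x(t/v) *)
Definition dsub (L : language) (x t v : term) := Fun (sym_sub L) [:: x; t; v].

(* Instances of formulas with free variables x_0 and x_1 are written as
   "exists x_0, x_0 = t /\ ...", which avoids renaming their bound variables.
   The terms plugged in must not contain x_0 or x_1: below, only variables of
   index at least 2 are used. *)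
Definition inst1 (A : form) (t : term) : form :=
  Ex 0 (And (Eq (Var 0) t) A).
Definition inst2 (A : form) (s t : term) : form :=
  Ex 0 (And (Eq (Var 0) s) (Ex 1 (And (Eq (Var 1) t) A))).

Definition fSent (L : language) (x : term) : form := inst1 (Sent_form L) x.
Definition fPr (L : language) (x : term) : form :=
  inst1 (Ex 1 (Prf_form L)) x.

(* Quantification over codes of closed terms. *)
Definition AllT (L : language) (t : nat) (A : form) : form :=
  All t (Imp (inst1 (ClTerm_form L) (Var t)) A).
Definition ExT (L : language) (t : nat) (A : form) : form :=
  Ex t (And (inst1 (ClTerm_form L) (Var t)) A).

(* The formula A(u) in which u stands for the value of the closed term coded
   by the variable t. *)
Definition WithVal (L : language) (u t : nat) (A : form) : form :=
  Ex u (And (inst2 (Val_form L) (Var t) (Var u)) A).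

Definition val_eq (L : language) (s t : nat) : form :=
  WithVal L 22 s (WithVal L 23 t (Eq (Var 22) (Var 23))).
Definition val_neq (L : language) (s t : nat) : form :=
  WithVal L 22 s (WithVal L 23 t (Neg (Eq (Var 22) (Var 23)))).

(* The only L_N-literals are s = t and ~ s = t. *)
Definition fTrue0 (L : language) (x : nat) : form :=
  Or (ExT L 20 (ExT L 21
        (And (Eq (Var x) (deq L (Var 20) (Var 21))) (val_eq L 20 21))))
     (ExT L 20 (ExT L 21
        (And (Eq (Var x) (dneq L (Var 20) (Var 21))) (val_neq L 20 21)))).

Definition bigOr (A : form) (l : seq form) : form := foldl Or A l.

(* xi(x, Tr), for a variable x of index between 2 and 9.  In the quantifier
   clauses the number z is substituted through its numeral. *)
Definition xi (L : language) (x : nat) : form :=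
  let X := Var x in
  let y := Var 10 in let z := Var 11 in let v := Var 12 in
  let t := Var 13 in let u := Var 14 in
  let yz := dsub L y (dnum L z) v in
  bigOr
    (fTrue0 L x)
    [:: Ex 10 (And (Eq X (dneg L (dneg L y))) (Tr y));
        Ex 10 (Ex 11 (And (Eq X (dor L y z)) (Or (Tr y) (Tr z))));
        Ex 10 (Ex 11 (And (Eq X (dneg L (dor L y z)))
                          (And (Tr (dneg L y)) (Tr (dneg L z)))));
        Ex 10 (Ex 11 (And (Eq X (dand L y z)) (And (Tr y) (Tr z))));
        Ex 10 (Ex 11 (And (Eq X (dneg L (dand L y z)))
                          (Or (Tr (dneg L y)) (Tr (dneg L z)))));
        Ex 10 (Ex 12 (And (Eq X (dall L v y)) (All 11 (Tr yz))));
        Ex 10 (Ex 12 (And (Eq X (dneg L (dall L v y)))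
                          (Ex 11 (Tr (dneg L yz)))));
        Ex 10 (Ex 12 (And (Eq X (dex L v y)) (Ex 11 (Tr yz))));
        Ex 10 (Ex 12 (And (Eq X (dneg L (dex L v y)))
                          (All 11 (Tr (dneg L yz)))));
        ExT L 13 (And (Eq X (dTr L t)) (WithVal L 14 13 (Tr u)));
        ExT L 13 (And (Eq X (dneg L (dTr L t)))
                      (WithVal L 14 13
                        (Or (Tr (dneg L u)) (Neg (fSent L u)))))].

Definition Theta (L : language) (S : set nat) : set nat :=
  [set n | forall e, sat (signature L) S e
     (Ex 2 (And (xi L 2) (fPr L (dimp L (Var 2) (numeral n)))))].

(** * The theory IT^- *)

Definition IT1 (L : language) : form :=
  And (AllT L 2 (AllT L 3
        (Iff (Tr (deq L (Var 2) (Var 3))) (val_eq L 2 3))))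
      (AllT L 2 (AllT L 3
        (Iff (Tr (dneq L (Var 2) (Var 3))) (val_neq L 2 3)))).

Definition IT2 (L : language) : form :=
  let x := Var 2 in let y := Var 3 in
  All 2 (All 3 (Imp (fSent L (dand L x y))
    (Imp (And (Tr x) (Tr y)) (Tr (dand L x y))))).

Definition IT3 (L : language) : form :=
  let x := Var 2 in let y := Var 3 in let z := Var 4 in
  All 2 (All 3 (Imp (fSent L (dor L x y))
    (Iff (bigOr (Tr x)
            [:: Tr y; Ex 4 (And (xi L 4) (fPr L (dimp L z (dor L x y))))])
         (Tr (dor L x y))))).

Definition IT4 (L : language) : form :=
  let x := Var 2 in let v := Var 3 in let t := Var 4 in
  All 2 (All 3 (Imp (fSent L (dall L v x))
    (Imp (AllT L 4 (Tr (dsub L x t v))) (Tr (dall L v x))))).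

Definition IT5 (L : language) : form :=
  let x := Var 2 in let v := Var 3 in let t := Var 4 in let w := Var 5 in
  All 2 (All 3 (Imp (fSent L (dex L v x))
    (Iff (Or (ExT L 4 (Tr (dsub L x t v)))
             (Ex 5 (And (xi L 5) (fPr L (dimp L w (dex L v x))))))
         (Tr (dex L v x))))).

Definition IT6m (L : language) : form :=
  All 2 (Imp (Tr (Var 2)) (Tr (dTr L (dnum L (Var 2))))).

(* On the left of the implication, t stands for its value: no code of a closed
   term is the code of a sentence. *)
Definition IT7m (L : language) : form :=
  AllT L 2 (Imp (WithVal L 3 2
                  (Or (Tr (dneg L (Var 3))) (Neg (fSent L (Var 3)))))
                (Tr (dneg L (dTr L (Var 2))))).

Definition IT8 (L : language) : form :=
  let x := Var 2 in let y := Var 3 in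
  All 2 (All 3 (Imp (And (Tr x) (fPr L (dimp L x y))) (Tr y))).

Definition IT9 (L : language) : form :=
  All 2 (Imp (Tr (dneg L (Var 2))) (Neg (Tr (Var 2)))).

Definition IT10 (L : language) : form :=
  Tr (numeral (code (All 0 (Imp (Tr (Var 0)) (Sent_form L))))).

Definition ITm (L : language) : set form :=
  [set A | PAT (signature L) A \/
     List.In A [:: IT1 L; IT2 L; IT3 L; IT4 L; IT5 L;
                   IT6m L; IT7m L; IT8 L; IT9 L; IT10 L]].

(** * The trivial fixed point *)

Lemma sat_Tr_free P S S' A : Tr_free A -> forall e, sat P S e A <-> sat P S' e A.
Proof.
elim: A => //=.
- by move=> A IH /IH h e; rewrite h.
- by move=> A IA B IB /andP[/IA ha /IB hb] e; rewrite ha hb.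
- by move=> A IA B IB /andP[/IA ha /IB hb] e; rewrite ha hb.
- by move=> v A IH /IH h e; split=> H n; apply/h; apply: H.
- by move=> v A IH /IH h e; split=> -[n H]; exists n; apply/h.
Qed.

Lemma teval_numeral I e n : teval I e (numeral n) = n.
Proof. by elim: n => //= n ->. Qed.

(* The set of all sentences is an inconsistent fixed point of [Theta]: each
   sentence A follows from A /\ A, which satisfies xi.  It violates [IT9], so
   it has to be excluded when fixed points are compared with models of
   [ITm]. *)
Lemma sentences_trivial_fixed_point L :
  Sentences (signature L) = Theta L (Sentences (signature L)) /\
  ~ models (signature L) (Sentences (signature L)) (ITm L).
Proof.
have hF S e : sat (signature L) S e (Prf_form L) <-> proves (signature L) (e 0) (e 1).
  rewrite -Prf_formP; apply: sat_Tr_free.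
  by have /and3P[] := Prf_form_ok L.
split; last first.
  move=> /(_ (IT9 L)) H.
  have {}H : forall e, sat (signature L) (Sentences (signature L)) e (IT9 L).
    by apply: H; right; do 8 right; left.
  pose A := Eq Zero Zero.
  have := H (fun=> 0) (code A); rewrite /= !/upd /= interp_neg.
  case=> [h|h]; apply: h; last by exists A.
  by exists (Neg A).
rewrite predeqE => n; split.
  case=> A sA -> e; exists (code (And A A)); split.
    rewrite /xi /bigOr; cbn [foldl sat]; do 7 left; right.
    exists (code A), (code A); rewrite /= /upd /= interp_and.
    by split=> //; split; (exists A).
  exists (code (Imp (And A A) A)); split.
    by rewrite /= /upd /= interp_imp !teval_numeral.
  exists (CodeSeq.code (map code [:: Imp (And A A) A])); apply/hF.
    rewrite /upd /=; exists (Imp (And A A) A), [::]; split=> //.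
    - move: sA; rewrite /sentence /= => /andP[-> /eqP ->]; by [].
    - apply: proof_logical; first exact: proof_nil.
        by move: sA => /andP[/= -> _].
      by apply: ax_taut => b /=; case: truth_value.
move=> /(_ (fun=>0)) [y [_]].
rewrite /fPr /inst1 => -[m []].
rewrite /= {1 3}/upd /= interp_imp !teval_numeral => em [p /hF].
rewrite /upd /= => -[B [l [sB eB _ _]]].
move: eB; rewrite em /upd /=.
case: B sB => [s t|t|A|A B|A B|v A|v A] sB /(can_inj CodeSeq.codeK) //= [_ ->].
exists B => //; move: sB; rewrite /sentence /= => /andP[/andP[_ ->]].
by case: (fv A).
Qed.

(* Main.v *)
(* Because A /\ A satisfies xi whenever A is in S, and A /\ A -> A is provable,
   every sentence of S lies in Theta(S).  So S is a fixed point iff S consists of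
   sentences, is closed under PAT-provable implication, and contains every
   sentence satisfying xi(., S).

   Such an S contains the true arithmetical sentences, since xi embodies the
   omega-rule; this gives IT10, and the other axioms are immediate, except IT9
   and half of IT1, which express consistency.  An inconsistent S would contain
   every sentence, which is excluded.

   Conversely, IT8 reduces Theta(S) <= S to the clauses of xi.  The quantifier
   clauses speak of numerals where IT4 speaks of closed terms, and the clause for
   Tr speaks of closed terms where IT6 speaks of numerals, so one needs that PAT
   proves t = n whenever n is the value of the closed term t.  If some n in S were
   not a sentence, then S would contain ~Sent(n), being true, but also Sent(n), by
   IT6 and IT10, contradicting IT9. *)
Require Import Defs.
From mathcomp Require Import all_boot.
From mathcomp Require Import boolp classical_sets.

Set Implicit Arguments.
Unset Strict Implicit.
Unset Printing Implicit Defensive.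

Local Open Scope classical_set_scope.

(** * Syntax *)

(** The generated induction principle has no hypothesis for the argument list of [Fun]; the inner
    fixpoint supplies one for each argument. *)
Fixpoint term_nested_ind (P : term -> Prop)
    (hV : forall v, P (Var v)) (h0 : P Zero)
    (hS : forall t, P t -> P (Succ t))
    (hA : forall s t, P s -> P t -> P (Add s t))
    (hM : forall s t, P s -> P t -> P (Mul s t))
    (hF : forall i ts, List.Forall P ts -> P (Fun i ts)) (t : term) : P t :=
  let IH := term_nested_ind hV h0 hS hA hM hF in
  match t with
  | Var v => hV v
  | Zero => h0
  | Succ t => hS _ (IH t)
  | Add s t => hA _ _ (IH s) (IH t)
  | Mul s t => hM _ _ (IH s) (IH t)
  | Fun i ts => hF i ts
      ((fix all_terms (l : seq term) : List.Forall P l :=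
          match l with
          | [::] => List.Forall_nil P
          | u :: l => List.Forall_cons u (IH u) (all_terms l)
          end) ts)
  end.

(** * Injectivity of the coding of terms and formulas *)

Lemma code_seq_inj : injective CodeSeq.code.
Proof. exact: can_inj CodeSeq.codeK. Qed.

Lemma tcode_inj : injective tcode.
Proof.
elim/term_nested_ind => [v||t IH|s t IHs IHt|s t IHs IHt|i ts IH]
  [w||t'|s' t'|s' t'|j us] /code_seq_inj //=.
- by case=> ->.
- by case=> /IH ->.
- by case=> /IHs -> /IHt ->.
- by case=> /IHs -> /IHt ->.
case=> -> h; congr (Fun _ _).
elim: {i j}ts us IH h => [|t ts IHts] [|u us] // IH /= [h1 h2].
by inversion_clear IH; rewrite (IHts us) // (H u).
Qed.

Lemma code_inj : injective code.
Proof.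
elim=> [s t|t|A IH|A IA B IB|A IA B IB|v A IA|v A IA]
  [s' t'|t'|A'|A' B'|A' B'|v' A'|v' A'] /code_seq_inj //=.
- by case=> /tcode_inj -> /tcode_inj ->.
- by case=> /tcode_inj ->.
- by case=> /IH ->.
- by case=> /IA -> /IB ->.
- by case=> /IA -> /IB ->.
- by case=> -> /IA ->.
- by case=> -> /IA ->.
Qed.

(** * Coincidence and substitution in the semantics *)

Lemma eval_ext I e e' t :
  (forall v, v \in fvt t -> e v = e' v) -> teval I e t = teval I e' t.
Proof.
elim/term_nested_ind: t => [v||t IH|s t IHs IHt|s t IHs IHt|i ts IH] //= h.
- by rewrite h ?inE.
- by rewrite IH.
- by rewrite IHs ?IHt // => v hv; apply: h; rewrite mem_cat hv ?orbT.
- by rewrite IHs ?IHt // => v hv; apply: h; rewrite mem_cat hv ?orbT.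
congr (I _ _); elim: ts IH h => //= t ts IHts H h; inversion_clear H.
rewrite H0 ?IHts // => v hv; apply: h; rewrite mem_cat hv ?orbT //.
Qed.

Lemma sat_ext P S e e' A :
  (forall v, v \in fv A -> e v = e' v) -> sat P S e A <-> sat P S e' A.
Proof.
have aux v n (e1 e2 : nat -> nat) B :
    (forall w, w \in [seq u <- fv B | u != v] -> e1 w = e2 w) ->
    forall w, w \in fv B -> upd e1 v n w = upd e2 v n w.
  move=> h w hw; rewrite /upd; case: eqP => // /eqP wv.
  by apply: h; rewrite mem_filter wv.
elim: A e e' => [s t|t|A IH|A IA B IB|A IA B IB|v A IA|v A IA] //= e e' h.
- by rewrite !(@eval_ext _ e e') // => v hv; apply: h; rewrite mem_cat hv ?orbT.
- by rewrite (@eval_ext _ e e').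
- by rewrite (IH e e').
- rewrite (IA e e') ?(IB e e') // => v hv; apply: h; rewrite mem_cat hv ?orbT //.
- rewrite (IA e e') ?(IB e e') // => v hv; apply: h; rewrite mem_cat hv ?orbT //.
- have eA n := IA _ _ (aux v n e e' A h).
  by split=> H n; apply/eA; apply: H.
- have eA n := IA _ _ (aux v n e e' A h).
  by split=> -[n H]; exists n; apply/eA.
Qed.

Lemma eval_substt I e r v t :
  teval I e (substt r v t) = teval I (upd e v (teval I e r)) t.
Proof.
elim/term_nested_ind: t => [w||t IH|s t IHs IHt|s t IHs IHt|i ts IH] //=.
- by rewrite /upd; case: ifP.
- by rewrite IH.
- by rewrite IHs IHt.
- by rewrite IHs IHt.
congr (I _ _); elim: IH => //= u us -> _ ->; by [].
Qed.

(** Although [subst] does not rename, no capture occurs: below a binder [w] other than [v], the term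
    [r] does not mention [w]. Allowing [v] itself in [r] covers both closed terms and the
    [Succ (Var v)] of the induction scheme. *)
Lemma sat_subst P S e r v A : {subset fvt r <= [:: v]} ->
  sat P S e (subst r v A) <-> sat P S (upd e v (teval (interp P) e r)) A.
Proof.
move=> cr.
have swap w n e1 : w != v -> forall u,
    upd (upd e1 w n) v (teval (interp P) (upd e1 w n) r) u =
    upd (upd e1 v (teval (interp P) e1 r)) w n u.
  move=> wv u; rewrite (@eval_ext _ (upd e1 w n) e1) /upd => [|x /cr].
    by case: (eqVneq u v) => // ->; rewrite eq_sym (negbTE wv).
  by rewrite inE => /eqP ->; rewrite eq_sym (negbTE wv).
have quant w B e1 n : (forall e, sat P S e (subst r v B) <->
      sat P S (upd e v (teval (interp P) e r)) B) ->
    sat P S (upd e1 w n) (if w == v then B else subst r v B) <->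
    sat P S (upd (upd e1 v (teval (interp P) e1 r)) w n) B.
  move=> IB; case: (eqVneq w v) => [->|wv].
    by apply: sat_ext => u _; rewrite /upd; case: eqP.
  by rewrite IB; apply: sat_ext => u _; exact: swap.
elim: A e => [s t|t|A IH|A IA B IB|A IA B IB|w A IA|w A IA] //= e.
- by rewrite !eval_substt.
- by rewrite eval_substt.
- by rewrite IH.
- by rewrite IA IB.
- by rewrite IA IB.
- rewrite (_ : (if _ then _ else _) = All w (if w == v then A else subst r v A)).
    by split=> H n; apply/quant => //; exact: H.
  by case: eqP.
- rewrite (_ : (if _ then _ else _) = Ex w (if w == v then A else subst r v A)).
    by split=> -[n H]; exists n; apply/quant.
  by case: eqP.
Qed.

(** * Syntactic invariants of substitution *)

Lemma fvt_substt r v t : fvt r = [::] ->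
  fvt (substt r v t) = [seq w <- fvt t | w != v].
Proof.
move=> cr.
elim/term_nested_ind: t => [w||t IH|s t IHs IHt|s t IHs IHt|i ts IH] //=.
- by case: eqP.
- by rewrite filter_cat IHs IHt.
- by rewrite filter_cat IHs IHt.
by elim: IH => //= u us -> _ ->; rewrite filter_cat.
Qed.

Lemma fv_subst r v A : fvt r = [::] ->
  fv (subst r v A) = [seq w <- fv A | w != v].
Proof.
move=> cr.
elim: A => [s t|t|A IH|A IA B IB|A IA B IB|w A IA|w A IA] //=;
  rewrite ?filter_cat ?fvt_substt ?IA ?IB //.
- case: (eqVneq w v) => [->|_] /=; rewrite ?IA -!filter_predI;
    by apply: eq_filter => u /=; rewrite ?andbb // andbC.
- case: (eqVneq w v) => [->|_] /=; rewrite ?IA -!filter_predI;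
    by apply: eq_filter => u /=; rewrite ?andbb // andbC.
Qed.

Lemma term_ok_substt P r v t :
  term_ok P r -> term_ok P t -> term_ok P (substt r v t).
Proof.
move=> hr.
elim/term_nested_ind: t => [w||t IH|s t IHs IHt|s t IHs IHt|i ts IH] //=.
- by case: eqP.
- by case/andP=> /IHs -> /IHt ->.
- by case/andP=> /IHs -> /IHt ->.
case/andP=> ar h; rewrite size_map ar /=.
by elim: IH h => //= u us Hu _ IHus /andP[/Hu -> /IHus ->].
Qed.

Lemma form_ok_subst P r v A :
  term_ok P r -> form_ok P A -> form_ok P (subst r v A).
Proof.
move=> hr.
elim: A => [s t|t|A IH|A IA B IB|A IA B IB|w A IA|w A IA] //=.
- by case/andP=> hs ht; rewrite !term_ok_substt.
- exact: term_ok_substt.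
- by case/andP=> /IA -> /IB ->.
- by case/andP=> /IA -> /IB ->.
- by case: eqP.
- by case: eqP.
Qed.

Lemma Tr_free_subst r v A : Tr_free (subst r v A) = Tr_free A.
Proof.
elim: A => [s t|t|A IH|A IA B IB|A IA B IB|w A IA|w A IA] //=;
  rewrite ?IA ?IB //; by case: eqP => //= _; rewrite IA.
Qed.

Lemma free_for_closed r v A : fvt r = [::] -> free_for r v A.
Proof.
move=> cr; elim: A => //=.
- by move=> A -> B ->.
- by move=> A -> B ->.
- by move=> w A ->; rewrite cr /= orbT.
- by move=> w A ->; rewrite cr /= orbT.
Qed.

Lemma substt_id r v t : v \notin fvt t -> substt r v t = t.
Proof.
elim/term_nested_ind: t => [w||t IH|s t IHs IHt|s t IHs IHt|i ts IH] //=.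
- by rewrite inE eq_sym; case: eqP.
- by move=> /IH ->.
- by rewrite mem_cat negb_or => /andP[/IHs -> /IHt ->].
- by rewrite mem_cat negb_or => /andP[/IHs -> /IHt ->].
move=> h; congr (Fun _ _); elim: IH h => //= u us Hu _ IHus.
by rewrite mem_cat negb_or => /andP[/Hu -> /IHus ->].
Qed.

Lemma closed_termP P t : reflect (term_ok P t /\ fvt t = [::]) (closed_term P t).
Proof.
rewrite /closed_term /term_in; apply: (iffP andP) => -[-> h]; split=> //.
  by case: (fvt t) h.
by rewrite h.
Qed.

Lemma closed_numeral P n : closed_term P (numeral n).
Proof. by apply/closed_termP; split; elim: n. Qed.

Lemma fvt_numeral n : fvt (numeral n) = [::].
Proof. by elim: n. Qed.

Lemma sentence_or P A B : sentence P (Or A B) = sentence P A && sentence P B.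
Proof.
rewrite /sentence /=; case: (fv A) => [|v l]; last by rewrite !andbF.
by rewrite /= eqxx andbT andbA.
Qed.

Lemma sentence_and P A B : sentence P (And A B) = sentence P A && sentence P B.
Proof. exact: sentence_or. Qed.

Lemma sentence_imp P A B : sentence P (Imp A B) = sentence P A && sentence P B.
Proof. exact: sentence_or. Qed.

Lemma sentence_neg P A : sentence P (Neg A) = sentence P A.
Proof. by []. Qed.

Lemma sentence_subst P r v A : closed_term P r ->
  sentence P (All v A) -> sentence P (subst r v A).
Proof.
case/closed_termP=> rok cr /andP[/= Aok /eqP cA].
by rewrite /sentence form_ok_subst // fv_subst // cA.
Qed.

(** * Provability in PAT *)

Lemma in_catl (T : Type) (x : T) l1 l2 : List.In x l1 -> List.In x (l1 ++ l2).
Proof. by elim: l1 => //= y l IH [->|/IH]; [left|right]. Qed.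

Lemma in_catr (T : Type) (x : T) l1 l2 : List.In x l2 -> List.In x (l1 ++ l2).
Proof. by elim: l1 => //= y l IH /IH; right. Qed.

Lemma in_cat_or (T : Type) (x : T) l1 l2 :
  List.In x (l1 ++ l2) -> List.In x l1 \/ List.In x l2.
Proof.
by elim: l1 => [|y l IH] /=; [right|case=> [->|/IH[]]; auto].
Qed.

Section Provability.
Variable P : prsig.

Definition thm (A : form) : Prop :=
  form_ok P A /\ exists l, PAT_proof P (A :: l).

Lemma PAT_proof_cat l1 l2 :
  PAT_proof P l1 -> PAT_proof P l2 -> PAT_proof P (l1 ++ l2).
Proof.
move=> h1 h2; elim: h1 => //= [A l _ IH|A l _ IH|A B l _ IH hA hAB|v A l _ IH hA].
- exact: proof_logical.
- exact: proof_axiom.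
- by apply: (@proof_mp _ A) => //; apply: in_catl.
- by apply: proof_gen => //; apply: in_catl.
Qed.

Lemma thm_logical A : form_ok P A -> logical_axiom A -> thm A.
Proof.
by move=> ok ax; split=> //; exists [::]; apply: proof_logical => //; apply: proof_nil.
Qed.

Lemma thm_PAT A : form_ok P A -> PAT P A -> thm A.
Proof.
by move=> ok ax; split=> //; exists [::]; apply: proof_axiom => //; apply: proof_nil.
Qed.

Lemma thm_mp A B : thm A -> thm (Imp A B) -> thm B.
Proof.
move=> [_ [l1 h1]] [/= /andP[_ okB] [l2 h2]]; split=> //.
exists ((A :: l1) ++ (Imp A B :: l2)).
apply: (@proof_mp _ A); first exact: PAT_proof_cat.
  by left.
by apply: in_catr; left.
Qed.

Lemma thm_gen v A : thm A -> thm (All v A).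
Proof.
move=> [ok [l h]]; split=> //; exists (A :: l).
by apply: proof_gen => //; left.
Qed.

Lemma thm_taut A : form_ok P A -> tautology A -> thm A.
Proof. by move=> ok ht; apply: thm_logical => //; apply: ax_taut. Qed.

Lemma thm_all_inst v A t : closed_term P t -> form_ok P A ->
  thm (Imp (All v A) (subst t v A)).
Proof.
case/closed_termP=> okt ct okA; apply: thm_logical.
  by rewrite /= okA form_ok_subst.
by apply: ax_all_inst; apply: free_for_closed.
Qed.

(** Generalization followed by instantiation. *)
Lemma thm_subst t v A : closed_term P t -> thm A -> thm (subst t v A).
Proof. by move=> ct hA; apply: thm_mp (thm_gen v hA) (thm_all_inst v ct hA.1). Qed.

Lemma thm_imp_trans A B C : thm (Imp A B) -> thm (Imp B C) -> thm (Imp A C).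
Proof.
move=> hAB hBC; have [/= /andP[okA okB] _] := hAB.
have [/= /andP[_ okC] _] := hBC.
apply: thm_mp hBC (thm_mp hAB (thm_taut _ _)).
  by rewrite /= okA okB okC.
by move=> b /=; case: (truth_value b A) (truth_value b B) (truth_value b C) => [] [] [].
Qed.

Lemma thm_contra A B : thm (Imp A B) -> thm (Imp (Neg B) (Neg A)).
Proof.
move=> h; have [/= okAB _] := h; apply: thm_mp h (thm_taut _ _).
  by case/andP: okAB => /= -> ->.
by move=> b /=; case: (truth_value b A) (truth_value b B) => [] [].
Qed.

(** The axiom [ax_ex] reduces this to instantiating [All v (Neg A)]; what remains is propositional,
    with quantified formulas as atoms. *)
Lemma thm_ex_intro v A t : closed_term P t -> form_ok P A ->
  thm (Imp (subst t v A) (Ex v A)).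
Proof.
move=> ct okA; have okt : term_ok P t by case/closed_termP: ct.
have hex : thm (Iff (Ex v A) (Neg (All v (Neg A)))).
  by apply: thm_logical; [rewrite /= okA|exact: ax_ex].
have hinst := @thm_all_inst v (Neg A) t ct okA.
apply: thm_mp hex (thm_mp hinst (thm_taut _ _)).
  by rewrite /= okA form_ok_subst.
by move=> b /=; case: (b (All _ _)) (b (Ex _ _)) (truth_value b (subst t v A)) => [] [] [].
Qed.

Lemma thm_negex v A : form_ok P A -> thm (Imp (All v (Neg A)) (Neg (Ex v A))).
Proof.
move=> okA; have hex : thm (Iff (Ex v A) (Neg (All v (Neg A)))).
  by apply: thm_logical; [rewrite /= okA|exact: ax_ex].
apply: thm_mp hex (thm_taut _ _); first by rewrite /= okA.
by move=> b /=; case: (b (All _ _)) (b (Ex _ _)) => [] [].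
Qed.

Lemma thm_taut_sentence A : sentence P A -> tautology A -> thm A.
Proof. by case/andP=> okA _; apply: thm_taut. Qed.

(** * Evaluation of closed terms in PAT *)

(** Both sides are required to be closed so that every substitution is capture-free and
    [ax_eq_subst] always applies. *)
Definition eqthm (s t : term) : Prop :=
  [/\ closed_term P s, closed_term P t & thm (Eq s t)].

Lemma eqthm_refl t : closed_term P t -> eqthm t t.
Proof.
move=> ct; split=> //; apply: thm_logical; last exact: ax_eq_refl.
by case/closed_termP: ct => /= ->.
Qed.

Lemma thm_eq_subst s t v A : form_ok P A -> eqthm s t ->
  thm (Imp (subst s v A) (subst t v A)).
Proof.
move=> okA [/closed_termP[oks cs] /closed_termP[okt ct] st].
apply: thm_mp st _; apply: thm_logical.
  by rewrite /= oks okt !form_ok_subst.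
by apply: ax_eq_subst; apply: free_for_closed.
Qed.

Lemma eqthm_sym s t : eqthm s t -> eqthm t s.
Proof.
move=> st; have [cs ct h] := st; split=> //.
have [okS vs] := closed_termP _ _ cs.
(* Leibniz's law for the formula x_0 = s turns s = s into t = s. *)
have /= := @thm_eq_subst s t 0 (Eq (Var 0) s) _ st.
rewrite !(@substt_id _ _ s) ?vs // => /(_ okS); apply: thm_mp.
by case: (eqthm_refl cs).
Qed.

Lemma eqthm_trans s t u : eqthm s t -> eqthm t u -> eqthm s u.
Proof.
move=> st tu; have [cs ct h] := st; have [_ cu _] := tu; split=> //.
have [okS vs] := closed_termP _ _ cs.
(* Leibniz's law for the formula s = x_0 turns s = t into s = u. *)
have /= := @thm_eq_subst t u 0 (Eq s (Var 0)) _ tu.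
by rewrite !(@substt_id _ _ s) ?vs // andbT => /(_ okS); apply: thm_mp.
Qed.

Lemma eqthm_context s t v c : term_ok P c -> {subset fvt c <= [:: v]} ->
  eqthm s t -> eqthm (substt s v c) (substt t v c).
Proof.
move=> okc fvc st; have [cs ct h] := st.
have [oks vs] := closed_termP _ _ cs; have [okt vt] := closed_termP _ _ ct.
have closed r : closed_term P r -> closed_term P (substt r v c).
  case/closed_termP=> okr vr; apply/closed_termP; split.
    exact: term_ok_substt.
  rewrite fvt_substt //; elim: (fvt c) fvc => //= w l IH wl.
  have := wl w; rewrite !inE eqxx => /(_ isT) ->.
  by apply: IH => u ul; apply: wl; rewrite inE ul orbT.
split; [exact: closed|exact: closed|].
(* With c[s] fixed on the left, Leibniz's law turns c[s] = c[s] into c[s] = c[t]. *)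
have /= := @thm_eq_subst s t v (Eq (substt s v c) c) _ st.
have [_ vsc] := closed_termP _ _ (closed _ cs).
rewrite okc term_ok_substt // !(@substt_id _ _ (substt s v c)) ?vsc //.
by move=> /(_ isT); apply: thm_mp; case: (eqthm_refl (closed _ cs)).
Qed.

Lemma eqthm_succ s t : eqthm s t -> eqthm (Succ s) (Succ t).
Proof. by apply: (@eqthm_context _ _ 0 (Succ (Var 0))). Qed.

Lemma eqthm_binop (op : term -> term -> term) s s' t t' :
  (op = Add \/ op = Mul) ->
  eqthm s s' -> eqthm t t' -> eqthm (op s t) (op s' t').
Proof.
move=> hop ss' tt'; have [cs cs' _] := ss'; have [ct ct' _] := tt'.
have [oks' vs'] := closed_termP _ _ cs'; have [okt vt] := closed_termP _ _ ct.
apply: (@eqthm_trans _ (op s' t)).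
  have := @eqthm_context s s' 0 (op (Var 0) t).
  by case: hop => -> /=; rewrite okt vt !(@substt_id _ _ t) ?vt //; apply.
have := @eqthm_context t t' 0 (op s' (Var 0)).
by case: hop => -> /=; rewrite oks' vs' !(@substt_id _ _ s') ?vs' //; apply.
Qed.

(** By [eqthm_context] one argument is replaced at a time, from left to right; [pre] holds the
    arguments already replaced. *)
Lemma eqthm_fun i ss ts : arity P i = Some (size ss) ->
  List.Forall2 eqthm ss ts -> eqthm (Fun i ss) (Fun i ts).
Proof.
suff main pre : List.Forall (closed_term P) pre ->
    arity P i = Some (size (pre ++ ss)) -> List.Forall2 eqthm ss ts ->
    eqthm (Fun i (pre ++ ss)) (Fun i (pre ++ ts)).
  exact: (main [::] (List.Forall_nil _)).
have closed_all l : List.Forall (closed_term P) l ->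
    [/\ all (term_ok P) l, flatten (map fvt l) = [::]
      & forall r, map (substt r 0) l = l].
  elim=> //= t l' /closed_termP[okt vt] _ [okl vl idl].
  by split=> [||r]; rewrite ?okt ?vt ?idl // substt_id ?vt.
move=> hpre ar h; elim: h pre hpre ar => [|s t ss' ts' st h IH] pre hpre ar.
  rewrite cats0; apply: eqthm_refl; apply/closed_termP.
  have [okp vp _] := closed_all _ hpre.
  by rewrite /= vp okp -(cats0 pre) ar eqxx.
have [cs ct _] := st.
have hss : List.Forall (closed_term P) ss'.
  by elim: h => [|? ? ? ? []]; constructor.
have [okp vp idp] := closed_all _ hpre; have [oks vs ids] := closed_all _ hss.
have hc := @eqthm_context s t 0 (Fun i (pre ++ Var 0 :: ss')).
apply: (@eqthm_trans _ (Fun i (pre ++ t :: ss'))).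
  move: hc; rewrite /= !map_cat /= !idp !ids; apply=> //.
    by rewrite all_cat /= okp oks ar !size_cat eqxx.
  by rewrite flatten_cat vp /= vs.
rewrite -!cat_rcons; apply: IH; last by rewrite cat_rcons ar !size_cat.
by elim: hpre => [|u l cu _ IHl] /=; [apply: List.Forall_cons | apply: List.Forall_cons].
Qed.

(** * Simultaneous substitution *)

Fixpoint tsub (rho : nat -> term) (t : term) : term :=
  match t with
  | Var v => rho v
  | Zero => Zero
  | Succ t => Succ (tsub rho t)
  | Add s t => Add (tsub rho s) (tsub rho t)
  | Mul s t => Mul (tsub rho s) (tsub rho t)
  | Fun i ts => Fun i (map (tsub rho) ts)
  end.

Lemma tsub_ext rho rho' t :
  (forall v, v \in fvt t -> rho v = rho' v) -> tsub rho t = tsub rho' t.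
Proof.
elim/term_nested_ind: t => [v||t IH|s t IHs IHt|s t IHs IHt|i ts IH] //= h.
- by rewrite h ?inE.
- by rewrite IH.
- by rewrite IHs ?IHt // => v hv; apply: h; rewrite mem_cat hv ?orbT.
- by rewrite IHs ?IHt // => v hv; apply: h; rewrite mem_cat hv ?orbT.
congr (Fun _ _); elim: IH h => //= u us Hu _ IHus h.
by rewrite Hu ?IHus // => v hv; apply: h; rewrite mem_cat hv ?orbT.
Qed.

Lemma tsub_substt rho r v t : tsub rho (substt r v t) =
  tsub (fun w => if w == v then tsub rho r else rho w) t.
Proof.
elim/term_nested_ind: t => [w||t IH|s t IHs IHt|s t IHs IHt|i ts IH] //=;
  rewrite ?IH ?IHs ?IHt //.
  by case: eqP.
by congr (Fun _ _); elim: IH => //= u us -> _ ->.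
Qed.

Lemma substt_tsub rho r v t :
  substt r v (tsub rho t) = tsub (fun w => substt r v (rho w)) t.
Proof.
elim/term_nested_ind: t => [w||t IH|s t IHs IHt|s t IHs IHt|i ts IH] //=;
  rewrite ?IH ?IHs ?IHt //.
by congr (Fun _ _); elim: IH => //= u us -> _ ->.
Qed.

Lemma tsub_var t : tsub Var t = t.
Proof.
elim/term_nested_ind: t => [w||t IH|s t IHs IHt|s t IHs IHt|i ts IH] //=;
  rewrite ?IH ?IHs ?IHt //.
by congr (Fun _ _); elim: IH => //= u us -> _ ->.
Qed.

Lemma term_ok_tsub rho t : (forall v, term_ok P (rho v)) ->
  term_ok P t -> term_ok P (tsub rho t).
Proof.
move=> okr.
elim/term_nested_ind: t => [w||t IH|s t IHs IHt|s t IHs IHt|i ts IH] //=.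
- by case/andP=> /IHs -> /IHt ->.
- by case/andP=> /IHs -> /IHt ->.
rewrite size_map => /andP[-> /=].
by elim: IH => //= u us Hu _ IHus /andP[/Hu -> /IHus ->].
Qed.

Lemma fvt_tsub rho t : (forall v, fvt (rho v) = [::]) -> fvt (tsub rho t) = [::].
Proof.
move=> cr.
elim/term_nested_ind: t => [w||t IH|s t IHs IHt|s t IHs IHt|i ts IH] //=;
  rewrite ?IHs ?IHt //.
by elim: IH => //= u us -> _ ->.
Qed.

(** Substituting for one variable at a time builds the simultaneous instance: since the terms
    [rho v] are closed, later substitutions leave them unchanged. [part k] has treated the variables
    below [k], and the final [k] exceeds every variable of both sides. *)
Lemma eqthm_instance rho s t : (forall v, closed_term P (rho v)) ->
  thm (Eq s t) -> eqthm (tsub rho s) (tsub rho t).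
Proof.
move=> cr h; have [/= /andP[oks okt] _] := h.
have okr v : term_ok P (rho v) by case/closed_termP: (cr v).
have vr v : fvt (rho v) = [::] by case/closed_termP: (cr v).
have closed u : term_ok P u -> closed_term P (tsub rho u).
  by move=> oku; apply/closed_termP; rewrite term_ok_tsub ?fvt_tsub.
split; [exact: closed|exact: closed|].
pose part k v := if v < k then rho v else Var v.
have step k u : substt (rho k) k (tsub (part k) u) = tsub (part k.+1) u.
  rewrite substt_tsub; apply: tsub_ext => v _; rewrite /part ltnS.
  case: (ltngtP v k) => [vk|kv|->] /=; first by rewrite substt_id ?vr.
    by rewrite gtn_eqF.
  by rewrite eqxx.
have main k : thm (Eq (tsub (part k) s) (tsub (part k) t)).
  elim: k => [|k IH]; first by rewrite !(@tsub_ext (part 0) Var) ?tsub_var.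
  by rewrite -!step; exact: (thm_subst k (cr k) IH).
pose k := \max_(v <- fvt s ++ fvt t) v.+1.
have fin u : {subset fvt u <= fvt s ++ fvt t} -> tsub rho u = tsub (part k) u.
  move=> sub; apply: tsub_ext => v /sub hv; rewrite /part.
  by rewrite (_ : v < k) // /k (big_rem v) //= leq_maxl.
by rewrite !fin // => v hv; rewrite mem_cat hv ?orbT.
Qed.

Lemma thm_instance rho s t : (forall v, closed_term P (rho v)) ->
  PAT P (Eq s t) -> term_ok P s -> term_ok P t ->
  eqthm (tsub rho s) (tsub rho t).
Proof.
by move=> cr ax oks okt; apply: eqthm_instance => //; apply: thm_PAT => //=; rewrite oks.
Qed.

(** * Provable computation with numerals *)

Lemma eqthm_add m n : eqthm (Add (numeral m) (numeral n)) (numeral (m + n)).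
Proof.
pose rho (v : nat) := if v == 0 then numeral m else numeral n.
elim: n @rho => [|n IH] rho.
  rewrite addn0; apply: (@thm_instance (fun=> numeral m) _ _ _ (PAT_add0 P)) => // v.
  exact: closed_numeral.
rewrite addnS.
apply: eqthm_trans (eqthm_succ IH).
apply: (@thm_instance (fun v => if v == 0 then numeral m else numeral n)
  _ _ _ (PAT_addS P)) => // v.
by case: eqP => _; exact: closed_numeral.
Qed.

Lemma eqthm_mul m n : eqthm (Mul (numeral m) (numeral n)) (numeral (m * n)).
Proof.
elim: n => [|n IH].
  rewrite muln0; apply: (@thm_instance (fun=> numeral m) _ _ _ (PAT_mul0 P)) => // v.
  exact: closed_numeral.
rewrite mulnSr.
have cm := closed_numeral P m.
apply: eqthm_trans
  (eqthm_trans (eqthm_binop (or_introl erefl) IH (eqthm_refl cm)) (eqthm_add _ _)).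
apply: (@thm_instance (fun v => if v == 0 then numeral m else numeral n)
  _ _ _ (PAT_mulS P)) => // v.
by case: eqP => _; exact: closed_numeral.
Qed.

(** [Q] will range over initial stages of the signature: provability stays fixed in [P], while the
    symbols are verified in their order of introduction. *)
Definition evaluates (Q : prsig) : Prop := forall i args,
  arity Q i = Some (size args) ->
  eqthm (Fun i (map numeral args)) (numeral (interp Q i args)).

(** Only provable equality of [rho v] with a numeral is assumed, so that [rho v] may also be a
    recursive call whose value is already computed. *)
Lemma eqthm_eval Q rho sigma t :
  (forall i k, arity Q i = Some k -> arity P i = Some k) -> evaluates Q ->
  term_ok Q t ->
  (forall v, v \in fvt t -> eqthm (rho v) (numeral (sigma v))) ->
  eqthm (tsub rho t) (numeral (teval (interp Q) sigma t)).
Proof.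
move=> sub ev.
elim/term_nested_ind: t => [w||t IH|s t IHs IHt|s t IHs IHt|i ts IH] /=.
- by move=> _; apply; rewrite inE.
- by move=> _ _; apply: eqthm_refl.
- by move=> okt h; apply: eqthm_succ; apply: IH.
- case/andP=> oks okt h; apply: eqthm_trans (eqthm_add _ _).
  apply: eqthm_binop; first by left.
    by apply: IHs => // v hv; apply: h; rewrite mem_cat hv.
  by apply: IHt => // v hv; apply: h; rewrite mem_cat hv orbT.
- case/andP=> oks okt h; apply: eqthm_trans (eqthm_mul _ _).
  apply: eqthm_binop; first by right.
    by apply: IHs => // v hv; apply: h; rewrite mem_cat hv.
  by apply: IHt => // v hv; apply: h; rewrite mem_cat hv orbT.
case/andP=> /eqP ar okts h.
apply: eqthm_trans (ev i _ _); last by rewrite size_map ar.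
apply: eqthm_fun; first by rewrite size_map; apply: sub.
elim: IH okts h {ar} => [|u us Hu _ IHus] /=; first by constructor.
case/andP=> oku okus h; constructor.
  by apply: Hu => // v hv; apply: h; rewrite mem_cat hv.
by apply: IHus => // v hv; apply: h; rewrite mem_cat hv orbT.
Qed.

End Provability.

(** * Extending a signature by newer symbols *)

Lemma arity_lt P i k : arity P i = Some k -> i < size P.
Proof.
elim: P => //= d P IH; case: eqP => [-> //|_ /IH lt].
by rewrite ltnS ltnW.
Qed.

(** The symbols of [R] have indices from [size P] on, so they cannot shadow those of [P]. *)
Lemma arity_cat R P i : i < size P -> arity (R ++ P) i = arity P i.
Proof.
move=> lt; elim: R => //= d R ->; rewrite size_cat ltn_eqF //.
exact: leq_trans lt (leq_addl _ _).
Qed.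

Lemma interp_cat R P i : i < size P -> interp (R ++ P) i = interp P i.
Proof.
move=> lt; elim: R => //= d R ->; rewrite size_cat ltn_eqF //.
exact: leq_trans lt (leq_addl _ _).
Qed.

Lemma term_ok_cat R P t : term_ok P t -> term_ok (R ++ P) t.
Proof.
elim/term_nested_ind: t => [w||t IH|s t IHs IHt|s t IHs IHt|i ts IH] //=.
- by case/andP=> /IHs -> /IHt ->.
- by case/andP=> /IHs -> /IHt ->.
case/andP=> /eqP ar h; rewrite (arity_cat _ (arity_lt ar)) ar eqxx /=.
by elim: IH h => //= u us Hu _ IHus /andP[/Hu -> /IHus ->].
Qed.

Lemma teval_cat R P e t :
  term_ok P t -> teval (interp (R ++ P)) e t = teval (interp P) e t.
Proof.
elim/term_nested_ind: t => [w||t IH|s t IHs IHt|s t IHs IHt|i ts IH] //=.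
- by move=> /IH ->.
- by case/andP=> /IHs -> /IHt ->.
- by case/andP=> /IHs -> /IHt ->.
case/andP=> /eqP ar h; rewrite (interp_cat _ (arity_lt ar)); congr (interp _ _ _).
by elim: IH h {ar} => //= u us Hu _ IHus /andP[/Hu -> /IHus ->].
Qed.

Lemma in_equations_cat R P A :
  List.In A (prsig_equations P) -> List.In A (prsig_equations (R ++ P)).
Proof. by elim: R => //= d R IH /IH; exact: in_catr. Qed.

Lemma size_vars n : size (vars n) = n.
Proof. by rewrite size_map size_iota. Qed.

Lemma term_ok_vars P n : all (term_ok P) (vars n).
Proof. by rewrite all_map; elim: (iota _ _) => //= v l ->. Qed.

Lemma map_tsub_vars args l (rho : nat -> term) :
  (forall k, k < size args -> rho k = numeral (nth 0 args k)) ->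
  l = size args -> map (tsub rho) (vars l) = map numeral args.
Proof.
move=> h ->; rewrite -map_comp -[in RHS](mkseq_nth 0 args) -map_comp.
by apply/eq_in_map => k; rewrite mem_iota /= add0n => /h.
Qed.

(* Induction on the order of introduction of the symbols; the values of a symbol
   introduced by recursion are computed by induction on its first argument. *)
Lemma evaluates_suffix R P : prsig_ok (R ++ P) -> evaluates (R ++ P) P.
Proof.
elim: P R => [|d P IH] R // okRP; rewrite -cat_rcons in okRP *.
(* The induction hypothesis, with [d] counted among the newer symbols, handles everything older than
   [d]. *)
have ev := IH _ okRP; have okd : prdef_ok P d.
  elim: R {IH ev} okRP => [|d' R IHR] /= /andP[] //.
rewrite cat_rcons in okRP ev *; set P0 := R ++ d :: P in ev *.
have P0E : P0 = rcons R d ++ P by rewrite cat_rcons.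
have sub i k : arity P i = Some k -> arity P0 i = Some k.
  by move=> ar; rewrite P0E (arity_cat _ (arity_lt ar)).
have ok0 t : term_ok P t -> term_ok P0 t by rewrite P0E; apply: term_ok_cat.
have eqs A : List.In A (defining_equations (size P) d) -> PAT P0 A.
  by move=> hA; apply: PAT_def; apply: in_equations_cat; apply: in_catl.
have ar0 : arity P0 (size P) = Some (prdef_arity d).
  by rewrite arity_cat /= ?eqxx.
move=> i args /=; case: eqP => [-> [ar]|_]; last exact: ev.
case: d okd P0 P0E ev sub ok0 eqs ar0 ar {okRP}
  => [n t|n g h] /= okd P0 P0E ev sub ok0 eqs ar0 ar.
  case/andP: okd => okt /allP ht; pose rho k := numeral (nth 0 args k).
  have crho k : closed_term P0 (rho k) by exact: closed_numeral.
  have inst := thm_instance crho (eqs _ (or_introl erefl)).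
  rewrite /= (@map_tsub_vars args) // in inst.
  apply: eqthm_trans (inst _ (ok0 _ okt)) _.
    by rewrite /= ar0 size_vars eqxx term_ok_vars.
  by apply: eqthm_eval => // v _; apply: eqthm_refl.
case/andP: okd => /andP[okg /allP hg] /andP[okh /allP hh].
case: args ar => // y xs /= [ar].
have arF ts : size ts = n -> all (term_ok P0) ts ->
    (arity P0 (size P) == Some (size ts).+1) && all (term_ok P0) ts.
  by move=> -> ->; rewrite ar0 eqxx.
elim: y => [|y IHy] /=.
  pose rho k := numeral (nth 0 xs k).
  have crho k : closed_term P0 (rho k) by exact: closed_numeral.
  have inst := thm_instance crho (eqs _ (or_introl erefl)).
  rewrite /= (@map_tsub_vars xs) // in inst.
  apply: eqthm_trans (inst _ (ok0 _ okg)) _.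
    by apply: arF; [exact: size_vars|exact: term_ok_vars].
  by apply: eqthm_eval => // v _; apply: eqthm_refl.
(* In the recursion equation the parameters are x_0, ..., x_{n-1} and the predecessor is x_n, hence
   [y] comes last. *)
pose rho k := numeral (nth 0 (rcons xs y) k).
have crho k : closed_term P0 (rho k) by exact: closed_numeral.
have inst := thm_instance crho (eqs _ (or_intror (or_introl erefl))).
have rhoE k : k < size xs -> rho k = numeral (nth 0 xs k).
  by move=> lt; rewrite /rho nth_rcons lt.
have rhoy : rho n = numeral y by rewrite /rho nth_rcons ar ltnn eqxx.
rewrite /= (@map_tsub_vars xs) // rhoy tsub_substt in inst.
apply: eqthm_trans (inst _ _) _.
- by apply: arF; [exact: size_vars|exact: term_ok_vars].
- apply: term_ok_substt; last exact: ok0.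
  by apply: arF; [exact: size_vars|exact: term_ok_vars].
(* The variable x_{n+1} stands for the recursive call, computed by [IHy]; all others receive
   numerals. *)
apply: eqthm_eval => // v /hh; rewrite ltnS leq_eqVlt => /orP[/eqP ->|].
  rewrite eqxx /= (@map_tsub_vars xs) // rhoy.
  by rewrite nth_cat ar ltnNge leqnSn subSnn; exact: IHy.
rewrite ltnS => vn; rewrite ltn_eqF ?ltnS //.
suff -> : rho v = numeral (nth 0 (xs ++ [:: y;
    nat_rec (fun=> nat) (teval (interp P) (nth 0 xs) g)
      (fun y0 r => teval (interp P) (nth 0 (xs ++ [:: y0; r])) h) y]) v).
  exact/eqthm_refl/closed_numeral.
rewrite /rho nth_rcons nth_cat -ar; move: vn; rewrite leq_eqVlt.
by case/orP=> [/eqP ->|->] //; rewrite ltnn eqxx subnn.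
Qed.

(** Numerals and closed terms thereby become interchangeable inside PAT, as the quantifier clauses
    and the clause for [Tr] demand. The whole signature is taken as its own suffix. *)
Lemma closed_term_value P t : prsig_ok P -> closed_term P t ->
  eqthm P t (numeral (teval (interp P) (fun=> 0) t)).
Proof.
move=> okP /closed_termP[okt ct]; rewrite -[X in eqthm _ X _]tsub_var.
by apply: eqthm_eval => //; [exact: (@evaluates_suffix [::])|rewrite ct].
Qed.

(** * Semantics *)

(** Classical, because implication abbreviates a disjunction. *)
Lemma sat_imp P S e A B : sat P S e (Imp A B) <-> (sat P S e A -> sat P S e B).
Proof.
split=> [[]|h] //.
by case: (pselect (sat P S e A)) => [/h|]; [right|left].
Qed.

Lemma sat_iff P S e A B : sat P S e (Iff A B) <-> (sat P S e A <-> sat P S e B).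
Proof.
by rewrite /Iff; split=> [[/sat_imp hAB /sat_imp hBA]|[hAB hBA]];
  split=> //; apply/sat_imp.
Qed.

Lemma eval_vars I e n k : k < n -> nth 0 (map (teval I e) (vars n)) k = e k.
Proof.
by move=> lt; rewrite -map_comp (nth_map 0) ?size_iota // nth_iota.
Qed.

(** [prdef_interp] satisfies the defining equations by construction. Newer symbols are carried in
    [R], because each symbol must be read in the full signature. *)
Lemma sat_defining_equations R P S e A : prsig_ok (R ++ P) ->
  List.In A (prsig_equations P) -> sat (R ++ P) S e A.
Proof.
elim: P R => [|d P IH] R okRP //= hA; case: (in_cat_or hA) => {}hA; last first.
  by rewrite -cat_rcons in okRP *; exact: IH.
have okd : prdef_ok P d.
  by elim: R {IH} okRP => [|d' R IHR] /= /andP[].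
have evE e' t : term_ok P t ->
    teval (interp (R ++ d :: P)) e' t = teval (interp P) e' t.
  by rewrite -cat_rcons; apply: teval_cat.
have IE args : interp (R ++ d :: P) (size P) args = prdef_interp (interp P) d args.
  by rewrite interp_cat /= ?eqxx.
case: d okd okRP evE IE hA => [n t|n g h] /=.
  move=> /andP[okt /allP ht] _ evE IE [<-|//] /=; rewrite IE evE //.
  by apply: eval_ext => v /ht lt; rewrite eval_vars.
move=> /andP[/andP[okg /allP hg] /andP[okh /allP hh]] _ evE IE [<-|[<-|//]] /=;
  rewrite IE /=.
  by rewrite evE //; apply: eval_ext => v /hg lt; rewrite eval_vars.
rewrite eval_substt evE //; apply: eval_ext => v /hh.
rewrite nth_cat size_map size_vars ltnS leq_eqVlt => /orP[/eqP ->|].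
  by rewrite ltnNge leqnSn subSnn /= /upd eqxx /= IE.
rewrite ltnS => vn; rewrite /upd ltn_eqF ?ltnS //.
by move: vn; rewrite leq_eqVlt => /orP[/eqP ->|vn]; rewrite ?ltnn ?subnn ?vn ?eval_vars.
Qed.

(** Induction holds for every [S]: it reduces to induction over the natural numbers for the
    predicate defined by the formula. *)
Lemma sat_PAT P S A e : prsig_ok P -> PAT P A -> sat P S e A.
Proof.
move=> okP; case=> {A} [||||||A hA|v A okA].
- by [].
- by apply/sat_imp => /= -[].
- exact: addn0.
- exact: addnS.
- exact: muln0.
- exact: mulnSr.
- exact: (@sat_defining_equations [::]).
apply/sat_imp => -[/sat_subst h0 hS] n; elim: n => [|n IHn]; first exact: h0.
have /sat_imp /(_ IHn) /sat_subst := hS n.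
(* [Succ (Var v)] contains only [v], and the second update of [v] overrides the first. *)
move=> /(_ (fun=> id)) /=; rewrite /upd eqxx /=; apply: iffLR; apply: sat_ext => w _.
by case: eqP.
Qed.

(** * Evaluating formulas that have terms plugged in *)

Lemma upd_eq e v n : upd e v n v = n.
Proof. by rewrite /upd eqxx. Qed.

Lemma upd_neq e v n w : w != v -> upd e v n w = e w.
Proof. by rewrite /upd => /negbTE ->. Qed.

Lemma eval_upd I e v n t : v \notin fvt t -> teval I (upd e v n) t = teval I e t.
Proof. by move=> vt; apply: eval_ext => w wt; rewrite upd_neq ?(memPn vt). Qed.

Lemma sat_AllE P S e v A :
  sat P S e (All v A) = forall n, sat P S (upd e v n) A.
Proof. by []. Qed.

Lemma sat_ExE P S e v A :
  sat P S e (Ex v A) = exists n, sat P S (upd e v n) A.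
Proof. by []. Qed.

Lemma sat_AndE P S e A B : sat P S e (And A B) = (sat P S e A /\ sat P S e B).
Proof. by []. Qed.

Lemma sat_OrE P S e A B : sat P S e (Or A B) = (sat P S e A \/ sat P S e B).
Proof. by []. Qed.

Lemma sat_NegE P S e A : sat P S e (Neg A) = ~ sat P S e A.
Proof. by []. Qed.

Lemma sat_inst1 P S e A t : 0 \notin fvt t ->
  sat P S e (inst1 A t) <-> sat P S (upd e 0 (teval (interp P) e t)) A.
Proof.
move=> t0; split=> /= [[n []]|h]; first by rewrite upd_eq eval_upd // => <-.
by exists (teval (interp P) e t); rewrite upd_eq eval_upd.
Qed.

Lemma sat_inst2 P S e A s t : 0 \notin fvt s -> 0 \notin fvt t -> 1 \notin fvt t ->
  sat P S e (inst2 A s t) <->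
  sat P S (upd (upd e 0 (teval (interp P) e s)) 1 (teval (interp P) e t)) A.
Proof.
move=> s0 t0 t1; split=> /= [[n [+ [m []]]]|h].
  by rewrite !upd_eq !eval_upd // => <- <-.
exists (teval (interp P) e s); split; first by rewrite upd_eq eval_upd.
by exists (teval (interp P) e t); rewrite upd_eq !eval_upd.
Qed.

(** * The arithmetized syntax read in the structures (N, S) *)

Section Language.
Variable L : language.
Notation P := (signature L).
Notation I := (interp P).

Definition interpE := (@interp_neg L, @interp_or L, @interp_and L, @interp_imp L,
  @interp_all L, @interp_ex L, @interp_eq L, @interp_neq L, @interp_Tr L,
  @interp_num L).

Definition value (t : term) : nat := teval I (fun=> 0) t.

Definition Provable (n : nat) : Prop :=
  exists A, [/\ sentence P A, n = code A & thm P A].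

Lemma sat_fSent S e t : 0 \notin fvt t ->
  sat P S e (fSent L t) <-> Sentences P (teval I e t).
Proof.
move=> t0; rewrite sat_inst1 // (@sat_Tr_free _ _ set0); first by rewrite Sent_formP upd_eq.
by case/and3P: (Sent_form_ok L).
Qed.

Lemma sat_fPr S e t : 0 \notin fvt t ->
  sat P S e (fPr L t) <-> Provable (teval I e t).
Proof.
move=> t0; rewrite sat_inst1 //; set n := teval I e t.
have hF k : sat P S (upd (upd e 0 n) 1 k) (Prf_form L) <-> proves P n k.
  rewrite (@sat_Tr_free _ _ set0); first by rewrite Prf_formP.
  by case/and3P: (Prf_form_ok L).
split=> [[k /hF [A [l [sA -> _ h]]]]|[A [sA eA [okA [l h]]]]].
  by exists A; split=> //; split; [case/andP: sA|exists l].
by exists (CodeSeq.code (map code (A :: l))); apply/hF; exists A, l.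
Qed.

Lemma sat_inst_ClTerm S e t : t != 0 ->
  sat P S e (inst1 (ClTerm_form L) (Var t)) <-> ClosedTerms P (e t).
Proof.
move=> t0; rewrite sat_inst1 ?inE 1?eq_sym // (@sat_Tr_free _ _ set0).
  by rewrite ClTerm_formP upd_eq.
by case/and3P: (ClTerm_form_ok L).
Qed.

Lemma sat_AllT S e t A : t != 0 -> sat P S e (AllT L t A) <->
  forall c, closed_term P c -> sat P S (upd e t (tcode c)) A.
Proof.
move=> t0; rewrite /AllT sat_AllE; split=> [h c cc|h n].
  move/sat_imp: (h (tcode c)); apply; rewrite sat_inst_ClTerm // upd_eq.
  by exists c.
by apply/sat_imp; rewrite sat_inst_ClTerm // upd_eq => -[c cc ->]; apply: h.
Qed.

Lemma sat_ExT S e t A : t != 0 -> sat P S e (ExT L t A) <->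
  exists2 c, closed_term P c & sat P S (upd e t (tcode c)) A.
Proof.
move=> t0; rewrite /ExT sat_ExE; split=> [[n]|[c cc h]].
  by rewrite sat_AndE sat_inst_ClTerm // upd_eq => -[[c cc ->] h]; exists c.
by exists (tcode c); rewrite sat_AndE; split=> //; rewrite sat_inst_ClTerm // upd_eq; exists c.
Qed.

(** By injectivity of [tcode] the code [e t] determines the term and hence its value, so the
    existential quantifier over [u] has exactly one possible witness. *)
Lemma sat_WithVal S e u t c A : t != 0 -> 1 < u -> t != u ->
  closed_term P c -> e t = tcode c ->
  sat P S e (WithVal L u t A) <-> sat P S (upd e u (value c)) A.
Proof.
move=> t0 u1 tu cc et.
have hV n : sat P S (upd e u n) (inst2 (Val_form L) (Var t) (Var u)) <->
    n = value c.
  rewrite sat_inst2 ?inE 1?eq_sym //; last 2 first.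
  - by case: u u1 {tu}.
  - by case: u u1 {tu} => [|[]].
  rewrite (@sat_Tr_free _ _ set0); last by case/and3P: (Val_form_ok L).
  rewrite Val_formP [upd _ 1 _ 0]upd_neq // !upd_eq /= (upd_neq _ _ tu) upd_eq et.
  by split=> [[c' cc' [/tcode_inj <- ->]]|->] //; exists c.
rewrite /WithVal sat_ExE; split=> [[n]|h]; first by rewrite sat_AndE => -[/hV ->].
by exists (value c); rewrite sat_AndE; split=> //; apply/hV.
Qed.

(** Indices below 22 stay clear of the variables 22 and 23 that hold the two values. *)
Lemma sat_val_eq S e s t c d : [&& s != 0, t != 0, s < 22 & t < 22] ->
  closed_term P c -> closed_term P d -> e s = tcode c -> e t = tcode d ->
  sat P S e (val_eq L s t) <-> value c = value d.
Proof.
case/and4P=> s0 t0 s22 t22 cc cd es et; rewrite /val_eq.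
have [ns nt nt'] : [/\ s != 22, t != 22 & t != 23].
  by rewrite !ltn_eqF // ltnW.
by rewrite (@sat_WithVal _ _ _ _ c) // (@sat_WithVal _ _ _ _ d) // upd_neq.
Qed.

Lemma sat_val_neq S e s t c d : [&& s != 0, t != 0, s < 22 & t < 22] ->
  closed_term P c -> closed_term P d -> e s = tcode c -> e t = tcode d ->
  sat P S e (val_neq L s t) <-> value c <> value d.
Proof.
case/and4P=> s0 t0 s22 t22 cc cd es et; rewrite /val_neq.
have [ns nt nt'] : [/\ s != 22, t != 22 & t != 23].
  by rewrite !ltn_eqF // ltnW.
by rewrite (@sat_WithVal _ _ _ _ c) // (@sat_WithVal _ _ _ _ d) // upd_neq.
Qed.

(** * The formula xi and the operator Theta as statements about [S] *)

Definition num_inst (y v z : nat) : nat := I (sym_sub L) [:: y; tcode (numeral z); v].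

(** The semantic counterpart of [xi], one constructor for each disjunct, except that [Xi_eq] and
    [Xi_neq] together make up True_0. It is not recursive: [S] is a fixed parameter, and the
    constructors only serve case analysis. *)
Inductive Xi (S : set nat) : nat -> Prop :=
| Xi_eq s t : closed_term P s -> closed_term P t -> value s = value t ->
    Xi S (Defs.geq (tcode s) (tcode t))
| Xi_neq s t : closed_term P s -> closed_term P t -> value s <> value t ->
    Xi S (gneq (tcode s) (tcode t))
| Xi_negneg y : S y -> Xi S (gneg (gneg y))
| Xi_or y z : S y \/ S z -> Xi S (gor y z)
| Xi_negor y z : S (gneg y) -> S (gneg z) -> Xi S (gneg (gor y z))
| Xi_and y z : S y -> S z -> Xi S (gand y z)
| Xi_negand y z : S (gneg y) \/ S (gneg z) -> Xi S (gneg (gand y z))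
| Xi_all v y : (forall z, S (num_inst y v z)) -> Xi S (gall v y)
| Xi_negall v y z : S (gneg (num_inst y v z)) -> Xi S (gneg (gall v y))
| Xi_ex v y z : S (num_inst y v z) -> Xi S (gex v y)
| Xi_negex v y : (forall z, S (gneg (num_inst y v z))) -> Xi S (gneg (gex v y))
| Xi_Tr t : closed_term P t -> S (value t) -> Xi S (gTr (tcode t))
| Xi_negTr t : closed_term P t -> S (gneg (value t)) \/ ~ Sentences P (value t) ->
    Xi S (gneg (gTr (tcode t))).

Lemma sat_True0 S e x : 1 < x < 20 -> sat P S e (fTrue0 L x) <->
  exists s t, [/\ closed_term P s, closed_term P t &
    (e x = Defs.geq (tcode s) (tcode t) /\ value s = value t) \/
    (e x = gneq (tcode s) (tcode t) /\ value s <> value t)].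
Proof.
case/andP=> x1 x20.
have xE m n : upd (upd e 20 m) 21 n x = e x by rewrite !upd_neq // ltn_eqF // ltnW.
rewrite /fTrue0 sat_OrE !sat_ExT //; split.
  case=> -[s cs]; rewrite sat_ExT // => -[t ct]; rewrite sat_AndE.
    rewrite (@sat_val_eq _ _ _ _ s t) //= xE /upd /= interpE => h.
    by exists s, t; split=> //; left.
  rewrite (@sat_val_neq _ _ _ _ s t) //= xE /upd /= interpE => h.
  by exists s, t; split=> //; right.
case=> s [t [cs ct]] [] h; [left|right]; exists s => //; rewrite sat_ExT //;
    exists t => //; rewrite sat_AndE.
  by rewrite (@sat_val_eq _ _ _ _ s t) //= xE /upd /= interpE.
by rewrite (@sat_val_neq _ _ _ _ s t) //= xE /upd /= interpE.
Qed.

(** An index below 10 is not captured by the quantified variables of [xi]. *)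
Lemma sat_xi S e x : 1 < x < 10 -> sat P S e (xi L x) <-> Xi S (e x).
Proof.
case/andP=> x1 x10.
have x20 : 1 < x < 20 by rewrite x1 (leq_trans x10).
have xk e' k n : 9 < k -> upd e' k n x = e' x.
  by move=> lt; rewrite upd_neq // ltn_eqF // (leq_trans x10).
rewrite /xi /bigOr; cbn [foldl]; split; last first.
  move Ex: (e x) => n h; case: h Ex
    => [s t cs ct st|s t cs ct st|y h|y z h|y z hy hz|y z hy hz|y z h
       |v y h|v y z h|v y z h|v y h|t ct h|t ct h] Ex.
  (* [bigOr] nests to the left, so the number of [left] steps picks out the disjunct. *)
  - by do 11 left; apply/(sat_True0 S e x20); exists s, t; split=> //; left.
  - by do 11 left; apply/(sat_True0 S e x20); exists s, t; split=> //; right.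
  - by do 10 left; right; exists y; rewrite /= !xk // /upd /= !interpE.
  - by do 9 left; right; exists y, z; rewrite /= !xk // /upd /= !interpE.
  - by do 8 left; right; exists y, z; rewrite /= !xk // /upd /= !interpE.
  - by do 7 left; right; exists y, z; rewrite /= !xk // /upd /= !interpE.
  - by do 6 left; right; exists y, z; rewrite /= !xk // /upd /= !interpE.
  - do 5 left; right; exists y, v; rewrite /= !xk // /upd /= !interpE; split=> // z.
    by rewrite interpE; apply: h.
  - do 4 left; right; exists y, v; rewrite /= !xk // /upd /= !interpE; split=> //.
    by exists z; rewrite !interpE.
  - do 3 left; right; exists y, v; rewrite /= !xk // /upd /= !interpE; split=> //.
    by exists z; rewrite !interpE.
  - do 2 left; right; exists y, v; rewrite /= !xk // /upd /= !interpE; split=> // z.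
    by rewrite !interpE; apply: h.
  - left; right; apply/sat_ExT => //; exists t => //; rewrite sat_AndE.
    by rewrite (@sat_WithVal _ _ _ _ t) //= !xk // /upd /= !interpE.
  right; apply/sat_ExT => //; exists t => //; rewrite sat_AndE.
  rewrite (@sat_WithVal _ _ _ _ t) // sat_OrE sat_NegE sat_fSent //= !xk //.
  by rewrite /upd /= !interpE.
rewrite !sat_OrE; case=> [[[[[[[[[[[h|h]|h]|h]|h]|h]|h]|h]|h]|h]|h]|h].
- have [s [t [cs ct [[-> st]|[-> st]]]]] := iffLR (sat_True0 S e x20) h.
    exact: Xi_eq.
  exact: Xi_neq.
- case: h => y; rewrite /= !xk // /upd /= !interpE => -[-> h]; exact: Xi_negneg.
- case: h => y [z]; rewrite /= !xk // /upd /= !interpE => -[-> h]; exact: Xi_or.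
- case: h => y [z]; rewrite /= !xk // /upd /= !interpE => -[-> [h1 h2]].
  exact: Xi_negor.
- case: h => y [z]; rewrite /= !xk // /upd /= !interpE => -[-> [h1 h2]].
  exact: Xi_and.
- case: h => y [z]; rewrite /= !xk // /upd /= !interpE => -[-> h]; exact: Xi_negand.
- case: h => y [v]; rewrite /= !xk // /upd /= !interpE => -[-> h].
  by apply: Xi_all => z; have := h z; rewrite !interpE.
- case: h => y [v]; rewrite /= !xk // /upd /= !interpE => -[-> [z]].
  by rewrite !interpE; exact: Xi_negall.
- case: h => y [v]; rewrite /= !xk // /upd /= !interpE => -[-> [z]].
  by rewrite !interpE; exact: Xi_ex.
- case: h => y [v]; rewrite /= !xk // /upd /= !interpE => -[-> h].
  by apply: Xi_negex => z; have := h z; rewrite !interpE.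
- move: h; rewrite sat_ExT // => -[t ct]; rewrite sat_AndE.
  rewrite (@sat_WithVal _ _ _ _ t) //= !xk // /upd /= !interpE => -[-> St].
  exact: Xi_Tr.
move: h; rewrite sat_ExT // => -[t ct]; rewrite sat_AndE.
rewrite (@sat_WithVal _ _ _ _ t) // sat_OrE sat_NegE sat_fSent //= !xk //.
by rewrite /upd /= !interpE => -[-> St]; exact: Xi_negTr.
Qed.

Lemma ThetaE S n :
  Theta L S n <-> exists2 y, Xi S y & Provable (gimp y n).
Proof.
have eqn e y : sat P S (upd e 2 y) (And (xi L 2) (fPr L (dimp L (Var 2) (numeral n))))
    <-> Xi S y /\ Provable (gimp y n).
  rewrite sat_AndE sat_xi // sat_fPr /= ?fvt_numeral //.
  by rewrite interpE teval_numeral upd_eq.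
split=> [/(_ (fun=> 0))|[y Xy Py] e]; rewrite sat_ExE.
  by move=> [y /eqn []]; exists y.
by exists y; apply/eqn.
Qed.

(** * The axioms of IT^- as closure conditions on [S] *)

Lemma sat_IT1 S e : sat P S e (IT1 L) <->
  (forall c d, closed_term P c -> closed_term P d ->
    (S (Defs.geq (tcode c) (tcode d)) <-> value c = value d)) /\
  (forall c d, closed_term P c -> closed_term P d ->
    (S (gneq (tcode c) (tcode d)) <-> value c <> value d)).
Proof.
have sat2 A (Q : term -> term -> Prop) :
    (forall c d, closed_term P c -> closed_term P d ->
      (sat P S (upd (upd e 2 (tcode c)) 3 (tcode d)) A <-> Q c d)) ->
    sat P S e (AllT L 2 (AllT L 3 A)) <->
    forall c d, closed_term P c -> closed_term P d -> Q c d.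
  move=> AQ; rewrite sat_AllT //; split=> h c.
    move=> d cc cd; apply/AQ => //; have := h c cc.
    by rewrite sat_AllT //; apply.
  by move=> cc; rewrite sat_AllT // => d cd; apply/AQ => //; apply: h.
rewrite /IT1 sat_AndE.
rewrite (sat2 _ (fun c d => S (Defs.geq (tcode c) (tcode d)) <-> value c = value d)).
  rewrite (sat2 _ (fun c d => S (gneq (tcode c) (tcode d)) <-> value c <> value d)) //.
  by move=> c d cc cd; rewrite sat_iff (@sat_val_neq _ _ _ _ c d) //= interpE.
by move=> c d cc cd; rewrite sat_iff (@sat_val_eq _ _ _ _ c d) //= interpE.
Qed.

Lemma sat_All2 S e u v A : sat P S e (All u (All v A)) <->
  forall m n, sat P S (upd (upd e u m) v n) A.
Proof. by []. Qed.

Lemma sat_IT2 S e : sat P S e (IT2 L) <->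
  forall x y, Sentences P (gand x y) -> S x /\ S y -> S (gand x y).
Proof.
rewrite /IT2 sat_All2 //; split=> h x y; have := h x y;
  by rewrite !sat_imp sat_fSent //= /upd /= interpE.
Qed.

Lemma sat_IT3 S e : sat P S e (IT3 L) <->
  forall x y, Sentences P (gor x y) ->
    ((S x \/ S y) \/ exists2 z, Xi S z & Provable (gimp z (gor x y))) <->
    S (gor x y).
Proof.
rewrite /IT3 sat_All2 // /bigOr; cbn [foldl].
have eqn x y : sat P S (upd (upd e 2 x) 3 y) (Ex 4 (And (xi L 4)
      (fPr L (dimp L (Var 4) (dor L (Var 2) (Var 3)))))) <->
    exists2 z, Xi S z & Provable (gimp z (gor x y)).
  by rewrite sat_ExE; split=> [[z]|[z hX hP]]; [|exists z];
    rewrite sat_AndE sat_xi // sat_fPr //= /upd /= !interpE // => -[]; exists z.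
split=> h x y; have := h x y;
  by rewrite sat_imp sat_fSent // sat_iff sat_OrE eqn /= /upd /= interpE.
Qed.

Lemma sat_IT4 S e : sat P S e (IT4 L) <->
  forall x v, Sentences P (gall v x) ->
    (forall c, closed_term P c -> S (I (sym_sub L) [:: x; tcode c; v])) ->
    S (gall v x).
Proof.
rewrite /IT4 sat_All2 //; split=> h x v; have := h x v;
  by rewrite !sat_imp sat_fSent // sat_AllT //= /upd /= interpE.
Qed.

Lemma sat_IT5 S e : sat P S e (IT5 L) <->
  forall x v, Sentences P (gex v x) ->
    ((exists2 c, closed_term P c & S (I (sym_sub L) [:: x; tcode c; v])) \/
     exists2 z, Xi S z & Provable (gimp z (gex v x))) <->
    S (gex v x).
Proof.
rewrite /IT5 sat_All2 //.
have eqn x y : sat P S (upd (upd e 2 x) 3 y) (Ex 5 (And (xi L 5)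
      (fPr L (dimp L (Var 5) (dex L (Var 3) (Var 2)))))) <->
    exists2 z, Xi S z & Provable (gimp z (gex y x)).
  by rewrite sat_ExE; split=> [[z]|[z hX hP]]; [|exists z];
    rewrite sat_AndE sat_xi // sat_fPr //= /upd /= !interpE // => -[]; exists z.
split=> h x y; have := h x y;
  by rewrite sat_imp sat_fSent // sat_iff sat_OrE eqn sat_ExT //= /upd /= interpE.
Qed.

Lemma sat_IT6m S e : sat P S e (IT6m L) <->
  forall x, S x -> S (gTr (tcode (numeral x))).
Proof.
rewrite /IT6m sat_AllE; split=> h x; have := h x;
  by rewrite sat_imp /= /upd /= !interpE.
Qed.

Lemma sat_IT7m S e : sat P S e (IT7m L) <->
  forall c, closed_term P c -> S (gneg (value c)) \/ ~ Sentences P (value c) ->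
    S (gneg (gTr (tcode c))).
Proof.
rewrite /IT7m sat_AllT //; split=> h c cc; have := h c cc;
  rewrite sat_imp (@sat_WithVal _ _ _ _ c) // sat_OrE sat_NegE sat_fSent //=;
  by rewrite /upd /= !interpE.
Qed.

Lemma sat_IT8 S e : sat P S e (IT8 L) <->
  forall x y, S x /\ Provable (gimp x y) -> S y.
Proof.
rewrite /IT8 sat_All2 //; split=> h x y; have := h x y;
  by rewrite sat_imp sat_AndE sat_fPr //= /upd /= interpE.
Qed.

Lemma sat_IT9 S e : sat P S e (IT9 L) <-> forall x, S (gneg x) -> ~ S x.
Proof.
rewrite /IT9 sat_AllE; split=> h x; have := h x;
  by rewrite sat_imp sat_NegE /= /upd /= interpE.
Qed.

Lemma sat_IT10 S e : sat P S e (IT10 L) <->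
  S (code (All 0 (Imp (Tr (Var 0)) (Sent_form L)))).
Proof. by rewrite /IT10; cbn [sat]; rewrite teval_numeral. Qed.

(** The axioms of PAT hold over the standard numbers whatever [S] is, so only the ten truth axioms
    constrain [S]. *)
Lemma models_ITm S : models P S (ITm L) <->
  forall A, List.In A [:: IT1 L; IT2 L; IT3 L; IT4 L; IT5 L;
    IT6m L; IT7m L; IT8 L; IT9 L; IT10 L] -> forall e, sat P S e A.
Proof.
split=> h A; first by move=> hA e; apply: h; right.
by case=> [hA e|]; [apply: sat_PAT (signature_ok L) hA|apply: h].
Qed.

(** * Fixed points of Theta *)

Lemma ProvableE A B : Provable (gimp (code A) (code B)) <->
  sentence P (Imp A B) /\ thm P (Imp A B).
Proof.
rewrite -[gimp _ _]/(code (Imp A B)); split=> [[C [sC /code_inj -> hC]]|[? ?]] //.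
by exists (Imp A B).
Qed.

(** Codes determine the outermost connectives, so a sentence whose code has the form of an
    implication is one. *)
Lemma Provable_gimp_inv x y : Provable (gimp x y) ->
  exists A B, [/\ x = code A, y = code B, sentence P A, sentence P B & thm P (Imp A B)].
Proof.
case=> C [sC eC hC]; case: C sC eC hC => [s t|t|A|A B|A B|v A|v A] sC /code_seq_inj [] //.
case: A sC => [s t|t|A|A1 A2|A1 A2|v A|v A] sC /code_seq_inj [] // -> -> hC.
by move: sC; rewrite sentence_imp => /andP[sA sB]; exists A, B.
Qed.

Definition deductively_closed (S : set nat) : Prop := forall A B,
  sentence P A -> sentence P B -> thm P (Imp A B) -> S (code A) -> S (code B).

(** The restriction to sentences matters: the code of a disjunction satisfies [Xi] as soon as one
    component is in [S], even if the other codes no formula. *)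
Definition progressive (S : set nat) : Prop := forall A,
  sentence P A -> Xi S (code A) -> S (code A).

(** Chaining implications gives deductive closure, and the provable [Imp A A] gives progressivity,
    with the code of [A] as the witness in [Theta]. *)
Lemma Theta_fixedE S : S = Theta L S <->
  [/\ S `<=` Sentences P, deductively_closed S & progressive S].
Proof.
split=> [fix_S|[sub clo prog]].
  have SE n : S n <-> exists2 y, Xi S y & Provable (gimp y n).
    by rewrite {1}fix_S ThetaE.
  split.
  - by move=> n /SE [y _ /Provable_gimp_inv [A [B [_ -> _ sB _]]]]; exists B.
  - move=> A B sA sB AB /SE [y Xy /Provable_gimp_inv [C [D]]].
    case=> yC /code_inj <- sC _ CA; apply/SE; exists y => //; rewrite yC.
    by apply/ProvableE; rewrite sentence_imp sC sB; split=> //; apply: thm_imp_trans AB.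
  move=> A sA XA; apply/SE; exists (code A) => //.
  apply/ProvableE; rewrite sentence_imp sA; split=> //.
  apply: thm_taut_sentence; first by rewrite sentence_imp sA.
  by move=> b /=; case: (truth_value b A).
rewrite predeqE => n; rewrite ThetaE; split=> [Sn|[y Xy]].
  have [A sA nA] := sub n Sn; rewrite nA in Sn *.
  exists (code (And A A)); first exact: Xi_and.
  apply/ProvableE; rewrite sentence_imp sentence_and sA; split=> //.
  apply: thm_taut_sentence; first by rewrite sentence_imp sentence_and sA.
  by move=> b /=; case: (truth_value b A).
(* Progressivity puts the witness into [S], and deductive closure then passes to its consequence. *)
move=> /Provable_gimp_inv [A [B [yA -> sA sB AB]]].
by apply: clo AB _ => //; apply: prog => //; rewrite -yA.
Qed.

(** * Arithmetic truth in progressive sets *)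

Lemma closed_value e t : closed_term P t -> teval I e t = value t.
Proof. by case/closed_termP=> _ ct; apply: eval_ext => v; rewrite ct. Qed.

Lemma num_inst_code A v z : form_ok P A ->
  num_inst (code A) v z = code (subst (numeral z) v A).
Proof. by move=> okA; apply: interp_sub => //; apply: closed_numeral. Qed.

(** A measure is needed because the quantifier cases pass to numeral instances, which are not
    subformulas; ignoring terms makes it invariant under substitution. *)
Fixpoint fsize (A : form) : nat :=
  match A with
  | Eq _ _ | Tr _ => 0
  | Neg A | All _ A | Ex _ A => (fsize A).+1
  | Or A B | And A B => (fsize A + fsize B).+1
  end.

Lemma fsize_subst r v A : fsize (subst r v A) = fsize A.
Proof.
elim: A => //= [A ->|A -> B ->|A -> B ->|w A IH|w A IH] //; case: eqP => //= _;
  by rewrite IH.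
Qed.

(* Xi evaluates quantifiers by the omega-rule, hence decides arithmetic truth. *)
Lemma progressive_true S e A : progressive S -> Tr_free A -> sentence P A ->
  (sat P S e A -> S (code A)) /\ (~ sat P S e A -> S (code (Neg A))).
Proof.
move=> prog; have [n] := ubnP (fsize A).
elim: n A => // n IHn [s t|t|A|A B|A B|v A|v A] lt TA sA.
- have [cs ct] : closed_term P s /\ closed_term P t.
    move: sA => /andP[/= /andP[oks okt] /eqP]; case es: (fvt s) => //= et.
    by split; apply/closed_termP.
  have -> : sat P S e (Eq s t) <-> value s = value t.
    by rewrite /= !(closed_value e).
  split=> h; apply: prog => //.
    exact: Xi_eq.
  exact: Xi_neq.
- by [].
(* Truth and falsity are treated together because negation exchanges them; falsity of [Neg A] uses
   the clause for double negation. *)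
- have [hA hN] := IHn A lt TA sA; split; first exact: hN.
  move=> h; apply: prog => //; apply: Xi_negneg; apply: hA.
  exact: contrapT.
- have /andP[sa sb] : sentence P A && sentence P B by rewrite -sentence_or.
  have /andP[Ta Tb] := TA.
  have [hA nA] := IHn A (leq_ltn_trans (leq_addr _ _) lt) Ta sa.
  have [hB nB] := IHn B (leq_ltn_trans (leq_addl _ _) lt) Tb sb.
  split=> h; apply: prog => //.
    by apply: Xi_or; case: h => [/hA|/hB]; [left|right].
  by apply: Xi_negor; [apply: nA|apply: nB] => h'; apply: h; [left|right].
- have /andP[sa sb] : sentence P A && sentence P B by rewrite -sentence_and.
  have /andP[Ta Tb] := TA.
  have [hA nA] := IHn A (leq_ltn_trans (leq_addr _ _) lt) Ta sa.
  have [hB nB] := IHn B (leq_ltn_trans (leq_addl _ _) lt) Tb sb.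
  split=> h; apply: prog => //.
    by case: h => /hA SA /hB SB; apply: Xi_and.
  apply: Xi_negand; have [/nA|/nB] : ~ sat P S e A \/ ~ sat P S e B.
    by apply/not_andP.
    by left.
  by right.
- have okA : form_ok P A by case/andP: sA.
  have ih z : (sat P S (upd e v z) A -> S (num_inst (code A) v z)) /\
      (~ sat P S (upd e v z) A -> S (gneg (num_inst (code A) v z))).
    have := IHn (subst (numeral z) v A); rewrite num_inst_code // fsize_subst.
    rewrite Tr_free_subst sat_subst ?fvt_numeral // teval_numeral; apply=> //.
    exact: sentence_subst (closed_numeral P z) sA.
  split=> h; apply: prog => //.
    by apply: Xi_all => z; apply: (ih z).1; apply: h.
  have [z hz] : exists z, ~ sat P S (upd e v z) A by apply/existsNP.
  by apply: (@Xi_negall _ _ _ z); apply: (ih z).2.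
- have okA : form_ok P A by case/andP: sA.
  have ih z : (sat P S (upd e v z) A -> S (num_inst (code A) v z)) /\
      (~ sat P S (upd e v z) A -> S (gneg (num_inst (code A) v z))).
    have := IHn (subst (numeral z) v A); rewrite num_inst_code // fsize_subst.
    rewrite Tr_free_subst sat_subst ?fvt_numeral // teval_numeral; apply=> //.
    exact: sentence_subst (closed_numeral P z) sA.
  split=> h; apply: prog => //.
    by case: h => z /(ih z).1; exact: Xi_ex.
  by apply: Xi_negex => z; apply: (ih z).2 => hz; apply: h; exists z.
Qed.

(** * Formulas recovered from codes, and reasoning inside deductively closed sets *)

Lemma code_gneg A x : code A = gneg x -> exists2 B, A = Neg B & x = code B.
Proof. by case: A => [s t|t|A|A B|A B|v A|v A] /code_seq_inj [] // <-; exists A. Qed.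

Lemma code_gor A x y : code A = gor x y ->
  exists B C, [/\ A = Or B C, x = code B & y = code C].
Proof.
by case: A => [s t|t|A|A B|A B|v A|v A] /code_seq_inj [] // <- <-; exists A, B.
Qed.

Lemma code_gand A x y : code A = gand x y ->
  exists B C, [/\ A = And B C, x = code B & y = code C].
Proof.
by case: A => [s t|t|A|A B|A B|v A|v A] /code_seq_inj [] // <- <-; exists A, B.
Qed.

Lemma code_gall A v x : code A = gall v x -> exists2 B, A = All v B & x = code B.
Proof. by case: A => [s t|t|A|A B|A B|w A|w A] /code_seq_inj [] // <- <-; exists A. Qed.

Lemma code_gex A v x : code A = gex v x -> exists2 B, A = Ex v B & x = code B.
Proof. by case: A => [s t|t|A|A B|A B|w A|w A] /code_seq_inj [] // <- <-; exists A. Qed.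

Lemma closed_taut S A B : deductively_closed S -> sentence P A -> sentence P B ->
  tautology (Imp A B) -> S (code A) -> S (code B).
Proof.
move=> clo sA sB taut; apply: clo => //.
by apply: thm_taut_sentence; rewrite ?sentence_imp ?sA.
Qed.

Lemma deductively_closedE S :
  (forall x y, S x /\ Provable (gimp x y) -> S y) <-> deductively_closed S.
Proof.
split=> [h A B sA sB AB SA|clo x y [Sx]].
  by apply: (h (code A)); split=> //; apply/ProvableE; rewrite sentence_imp sA.
by case/Provable_gimp_inv=> A [B [xA -> sA sB AB]]; apply: clo AB _; rewrite -?xA.
Qed.

(** Deductive closure has a single premise, so two members of [S] are first conjoined. The
    conjunction hypothesis comes from progressivity for fixed points and from IT2 for models. *)
Lemma closed_taut2 S A B C :
  deductively_closed S -> (S (code A) -> S (code B) -> S (code (And A B))) ->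
  sentence P A -> sentence P B -> sentence P C ->
  (forall b, truth_value b A -> truth_value b B -> truth_value b C) ->
  S (code A) -> S (code B) -> S (code C).
Proof.
move=> clo conj sA sB sC taut SA SB.
apply: (@closed_taut _ (And A B)) => //; rewrite ?sentence_and ?sA //; last exact: conj.
move=> b; have := taut b; rewrite /=.
by case: (truth_value b A) (truth_value b B) => [] [] //= -> .
Qed.

(** * Sentencehood in the object language *)

Definition all_true_are_sentences : form := All 0 (Imp (Tr (Var 0)) (Sent_form L)).

Lemma sentence_all_true : sentence P all_true_are_sentences.
Proof.
have /and3P[ok _ /allP h] := Sent_form_ok L.
rewrite /sentence /= ok /=; apply/eqP; apply/eqP; rewrite -size_eq0 size_filter.
by rewrite -leqn0 leqNgt -has_count; apply/hasPn => v /h; case: v.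
Qed.

Lemma sentence_Sent z : sentence P (subst (numeral z) 0 (Sent_form L)).
Proof.
have := sentence_subst (closed_numeral P z) sentence_all_true.
by rewrite sentence_imp => /andP[].
Qed.

Lemma sat_Sent S e z :
  sat P S e (subst (numeral z) 0 (Sent_form L)) <-> Sentences P z.
Proof.
rewrite sat_subst ?fvt_numeral // teval_numeral (@sat_Tr_free _ _ set0).
  by rewrite Sent_formP upd_eq.
by case/and3P: (Sent_form_ok L).
Qed.

Lemma Tr_free_Sent z : Tr_free (subst (numeral z) 0 (Sent_form L)).
Proof. by rewrite Tr_free_subst; case/and3P: (Sent_form_ok L). Qed.

Lemma value_numeral z : value (numeral z) = z.
Proof. exact: teval_numeral. Qed.

Lemma sentence_Eq s t : closed_term P s -> closed_term P t -> sentence P (Eq s t).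
Proof.
by case/closed_termP=> oks cs /closed_termP[okt ct]; rewrite /sentence /= oks okt cs ct.
Qed.

Lemma sentence_Tr t : closed_term P t -> sentence P (Tr t).
Proof. by case/closed_termP=> okt ct; rewrite /sentence /= okt ct. Qed.

(** * Nontrivial fixed points are models of IT^- *)

Lemma fixed_models S : S <> Sentences P -> S = Theta L S -> models P S (ITm L).
Proof.
move=> ntriv fix_S; have [sub clo prog] := iffLR (Theta_fixedE S) fix_S.
(* Read for disjunctions and existential sentences, this is the part of IT3 and IT5 that concerns xi
   and provability. *)
have SE n : S n <-> exists2 y, Xi S y & Provable (gimp y n).
  by rewrite {1}fix_S ThetaE.
have conj A B : sentence P A -> sentence P B -> S (code A) -> S (code B) ->
    S (code (And A B)).
  move=> sA sB SA SB; apply: prog; first by rewrite sentence_and sA.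
  exact: Xi_and.
(* A contradiction in [S] yields every sentence by deductive closure, against nontriviality. *)
have cons A : sentence P A -> S (code A) -> S (code (Neg A)) -> False.
  move=> sA SA SN; apply: ntriv; rewrite predeqE => n; split=> [/sub//|[B sB ->]].
  apply: (closed_taut2 clo (conj _ _ sA _) sA _ sB _ SA SN) => //.
  by move=> b /= ->.
have refl_xi n : Sentences P n -> Xi S n -> S n.
  by case=> A sA ->; apply: prog.
apply/models_ITm => A.
case=> [<-|[<-|[<-|[<-|[<-|[<-|[<-|[<-|[<-|[<-|[]]]]]]]]]]] e.
- apply/sat_IT1; split=> c d cc cd.
    split=> [h|h].
      (* If the values differ, the inequation is in True_0 and hence in [S], contradicting
         consistency. *)
      apply: contrapT => ne; apply: (@cons (Eq c d)) => //.
        exact: sentence_Eq.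
      by apply: prog; [exact: sentence_Eq|exact: Xi_neq].
    by apply: (prog (Eq c d)); [exact: sentence_Eq|exact: Xi_eq].
  split=> [h eq|h].
    apply: (@cons (Eq c d)) => //; first exact: sentence_Eq.
    by apply: prog; [exact: sentence_Eq|exact: Xi_eq].
  by apply: (prog (Neg (Eq c d))); [exact: sentence_Eq|exact: Xi_neq].
- by apply/sat_IT2 => x y sxy [Sx Sy]; apply: refl_xi => //; apply: Xi_and.
- apply/sat_IT3 => x y sxy; split=> [[h|/SE //]|/SE h]; last by right.
  by apply: refl_xi => //; apply: Xi_or.
(* Numerals are closed terms, so the hypothesis of IT4 covers all instances required by the
   omega-rule. *)
- apply/sat_IT4 => x v sxv h; apply: refl_xi => //; apply: Xi_all => z.
  exact/h/closed_numeral.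
(* The witness is a closed term and perhaps no numeral, so existential introduction in PAT takes the
   place of the clause of xi. *)
- apply/sat_IT5 => x v [B sB /esym eB]; split=> [[[c cc]|/SE //]|/SE h]; last by right.
  have [C eC xC] := code_gex eB; move: sB eB; rewrite {}eC {}xC => sC <-.
  have okC : form_ok P C by case/andP: sC.
  rewrite interp_sub //; apply: clo => //; first exact: sentence_subst cc _.
  exact: thm_ex_intro.
- apply/sat_IT6m => x Sx; apply: (prog (Tr (numeral x))).
    exact/sentence_Tr/closed_numeral.
  by apply: Xi_Tr; [exact: closed_numeral|rewrite value_numeral].
- apply/sat_IT7m => c cc h; apply: (prog (Neg (Tr c))); first exact: sentence_Tr.
  exact: Xi_negTr.
- exact/sat_IT8/deductively_closedE.
- apply/sat_IT9 => x SN Sx; have [B sB xB] := sub x Sx.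
  by rewrite xB in SN Sx; exact: cons sB Sx SN.
(* The omega-rule reduces IT10 to its numeral instances. *)
apply/sat_IT10; apply: (prog _ sentence_all_true).
apply: (@Xi_all _ 0 (code (Imp (Tr (Var 0)) (Sent_form L)))) => z.
have okB : form_ok P (Imp (Tr (Var 0)) (Sent_form L)).
  by case/andP: sentence_all_true.
rewrite num_inst_code //; apply: (prog _).
  exact: sentence_subst (closed_numeral P z) sentence_all_true.
(* Each instance is a disjunction: Sent(z) is in [S] when true, and otherwise the second half of the
   clause for negated [Tr] yields the negation of Tr(z). *)
apply: Xi_or; case: (pselect (Sentences P z)) => [sz|nsz]; [right|left].
  apply: (progressive_true e prog (Tr_free_Sent z) (sentence_Sent z)).1.
  exact/sat_Sent.
apply: (prog (Neg (Tr (numeral z)))); first exact/sentence_Tr/closed_numeral.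
by apply: Xi_negTr; [exact: closed_numeral|right; rewrite value_numeral].
Qed.

(** * Models of IT^- are fixed points *)

Lemma closed_term_inst S v B c : deductively_closed S -> closed_term P c ->
  sentence P (All v B) ->
  S (code (subst (numeral (value c)) v B)) -> S (code (subst c v B)).
Proof.
move=> clo cc sB; have okB : form_ok P B by case/andP: sB.
apply: clo; try exact: sentence_subst sB.
  exact: sentence_subst (closed_numeral P _) sB.
(* Leibniz's law for the provable equation between [c] and the numeral of its value. *)
apply: thm_eq_subst => //; apply: eqthm_sym.
exact: closed_term_value (signature_ok L) cc.
Qed.

Lemma models_fixed S : models P S (ITm L) -> S = Theta L S.
Proof.
move=> /models_ITm hI; pose e (_ : nat) := 0.
have hS k A eA := hI A (List.nth_error_In _ k eA) e.
have [h1a h1b] := iffLR (sat_IT1 S e) (hS 0 _ erefl).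
have h2 := iffLR (sat_IT2 S e) (hS 1 _ erefl).
have h3 := iffLR (sat_IT3 S e) (hS 2 _ erefl).
have h4 := iffLR (sat_IT4 S e) (hS 3 _ erefl).
have h5 := iffLR (sat_IT5 S e) (hS 4 _ erefl).
have h6 := iffLR (sat_IT6m S e) (hS 5 _ erefl).
have h7 := iffLR (sat_IT7m S e) (hS 6 _ erefl).
have h9 := iffLR (sat_IT9 S e) (hS 8 _ erefl).
have h10 := iffLR (sat_IT10 S e) (hS 9 _ erefl).
have clo : deductively_closed S.
  exact/deductively_closedE/(iffLR (sat_IT8 S e))/(hS 7).
have conj A B : sentence P A -> sentence P B -> S (code A) -> S (code B) ->
    S (code (And A B)).
  by move=> sA sB SA SB; apply: h2 => //; exists (And A B) => //; rewrite sentence_and sA.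
(* IT4 asks for all closed terms; instances at numerals suffice, since every closed term provably
   equals one. *)
have hall v B : sentence P (All v B) ->
    (forall z, S (code (subst (numeral z) v B))) -> S (code (All v B)).
  move=> sB h; apply: h4; first by exists (All v B).
  move=> c cc; rewrite interp_sub //; last by case/andP: sB.
  exact: closed_term_inst.
(* Each clause of [Xi] is matched with a truth axiom, with a PAT-provable implication, or with a
   combination of both. *)
have prog : progressive S.
  move=> A sA; move eA : (code A) => n XA.
  case: XA eA => [s t cs ct st|s t cs ct st|y h|y z h|y z hy hz|y z hy hz|y z h
     |v y h|v y z h|v y z h|v y h|t ct h|t ct h] eA.
  - exact/h1a.
  - exact/h1b.
  - have [B AB /esym/code_gneg [C BC yC]] := code_gneg eA.
    rewrite -eA {eA}AB {}BC in sA *; rewrite {}yC in h.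
    apply: closed_taut h => // b /=; by case: (truth_value b C).
  - by apply/h3; [exists A|left].
  - have [B AB /esym/code_gor [C [D [BC yC zD]]]] := code_gneg eA.
    rewrite -eA {eA}AB {}BC in sA *; rewrite {}yC in hy; rewrite {}zD in hz.
    move: (sA); rewrite sentence_neg sentence_or => /andP[sC sD].
    apply: (@closed_taut2 _ (Neg C) (Neg D)) hy hz => //; first exact: conj.
    by move=> b /= /negbTE -> /negbTE ->.
  - by apply: h2; [exists A|].
  - have [B AB /esym/code_gand [C [D [BC yC zD]]]] := code_gneg eA.
    rewrite -eA {eA}AB {}BC in sA *; rewrite {}yC {}zD in h.
    move: (sA); rewrite sentence_neg sentence_and => /andP[sC sD].
    case: h => h; [apply: (@closed_taut _ (Neg C)) h|apply: (@closed_taut _ (Neg D)) h];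
      by move=> // b /=; case: (truth_value b C) (truth_value b D) => [] [].
  - have [B AB yB] := code_gall eA; rewrite -eA {eA}AB in sA *.
    have okB : form_ok P B by case/andP: sA.
    by apply: hall => // z; have := h z; rewrite yB num_inst_code.
  - have [C AC /esym/code_gall [B CB yB]] := code_gneg eA.
    rewrite -eA {eA}AC {}CB in sA *; have okB : form_ok P B by case/andP: sA.
    rewrite yB num_inst_code // in h.
    apply: (clo (Neg (subst (numeral z) v B))) h => //.
      exact: sentence_subst (closed_numeral P z) sA.
    exact/thm_contra/thm_all_inst/okB/closed_numeral.
  - have [B AB yB] := code_gex eA; rewrite -eA {eA}AB in sA *.
    have okB : form_ok P B by case/andP: sA.
    rewrite yB num_inst_code // in h; apply: clo h => //.
      exact: sentence_subst (closed_numeral P z) sA.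
    exact/thm_ex_intro/okB/closed_numeral.
  - have [C AC /esym/code_gex [B CB yB]] := code_gneg eA.
    rewrite -eA {eA}AC {}CB in sA *; have okB : form_ok P B by case/andP: sA.
    (* The negated instances first give a universal sentence, from which PAT derives the negated
       existential one. *)
    have SA : S (code (All v (Neg B))).
      apply: (hall v (Neg B) sA) => z.
      by have := h z; rewrite yB num_inst_code.
    exact: (clo (All v (Neg B)) (Neg (Ex v B)) sA sA (thm_negex v okB) SA).
  (* IT6 applies to the numeral of the value, which PAT then identifies with [t]. *)
  - apply: (clo (Tr (numeral (value t))) (Tr t)); last exact: h6.
    + exact/sentence_Tr/closed_numeral.
    + exact: sentence_Tr.
    have /= := @thm_eq_subst P (numeral (value t)) t 0 (Tr (Var 0)) isT.
    by apply; apply/eqthm_sym/closed_term_value => //; exact: signature_ok.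
  exact: h7.
apply/Theta_fixedE; split=> // n Sn; apply: contrapT => nSn.
have := progressive_true e prog (Tr_free_Sent n) (sentence_Sent n).
case=> _ /(_ (fun h => nSn (iffLR (sat_Sent S e n) h))) SN.
apply: h9 SN _; have cn := closed_numeral P n.
(* The sentence of IT10 instantiated at [n]; together with Tr(n) from IT6 it puts Sent(n) into
   [S]. *)
have SI : S (code (Imp (Tr (numeral n)) (subst (numeral n) 0 (Sent_form L)))).
  apply: clo h10; first exact: sentence_all_true.
    exact: sentence_subst cn sentence_all_true.
  apply: (@thm_all_inst P 0 (Imp (Tr (Var 0)) (Sent_form L))) => //.
  by case/andP: sentence_all_true.
have sI : sentence P (Imp (Tr (numeral n)) (subst (numeral n) 0 (Sent_form L))).
  exact: sentence_subst cn sentence_all_true.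
have sT := sentence_Tr cn; have sF := sentence_Sent n.
apply: (@closed_taut2 _ (Tr (numeral n))) (h6 n Sn) SI => //.
  exact: conj.
by move=> b /= ->.
Qed.

End Language.

Theorem theorem6p2 (L : language) (S : set nat)
    (S_nontrivial : S <> Sentences (signature L)) :
  S = Theta L S <-> models (signature L) S (ITm L).
Proof. by split; [exact: fixed_models|exact: models_fixed]. Qed.
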